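(* (1) Let $(G,(X,e),\Theta:X\to G,G')$ be a relaxed augmented Lie rack, let $\mathfrak{g},\mathfrak{g}'$ be the Lie algebras of $G,G'$ (so $\mathfrak g'\subset\mathfrak g$), and let $V:=T_eX$. Give $V$ the structure of a $\mathfrak{g}$-module via the differential at $e\in X$ of the action of $G$ on $X$; explicitly, for $a\in\mathfrak{g}$ and $v\in V$, $$a\cdot v=\left.\frac{d}{dt}T_eL_{a(t)}(v)\right|_{t=0},$$ where $t\mapsto a(t)\in G$, $t\in[-1,1]$, is any smooth curve with $a(0)=e_G$ and $\frac{da}{dt}(0)=a$, and $L_g:X\to X$ denotes the action of $g\in G$ on $X$. Let $\theta=d\Theta=T_e\Theta:V\to\mathfrak{g}$ be the differential of $\Theta$ at $e$. Then $(\mathfrak{g},V,\theta,\mathfrak{g}')$ is a relaxed augmented Leibniz algebra. (It is called the tangent relaxed augmented Leibniz algebra of $(G,(X,e),\Theta,G')$.) (2) For $i=1,2$ let $(G_i,(X_i,e_i),\Theta_i:X_i\to G_i,G_i')$ be a relaxed augmented Lie rack, with underlying Lie group-rack triple $(G_i,X_i,\Theta_i)$ and tangent relaxed augmented Leibniz algebra $(\mathfrak{g}_i,V_i,\theta_i,\mathfrak{g}_i')$ as constructed in (1). Let $(\Phi,\Psi):(G_1,X_1,\Theta_1)\to(G_2,X_2,\Theta_2)$ be a morphism of Lie group-rack triples. Then $(\varphi,\psi):=(T_{e_{G_1}}\Phi,\,T_{e_1}\Psi)$ is a morphism of Lie-Leibniz triples $(\mathfrak{g}_1,V_1,\theta_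1)\to(\mathfrak{g}_2,V_2,\theta_2)$.
   Context: All manifolds and Lie groups are finite-dimensional (real, smooth). $e_G$ denotes the unit element of a group $G$. **Relaxed augmented Lie rack.** A tuple $(G,(X,e),\Theta,G')$ where $G$ is a Lie group acting smoothly on a smooth manifold $X$ with a distinguished point $e\in X$ satisfying $g\cdot e=e$ for all $g\in G$, $\Theta:X\to G$ is a smooth map, and $G'\subset G$ is a Lie subgroup containing $\mathrm{Im}(\Theta)$, such that $\Theta(e)=e_G$ and $\Theta(g\cdot x)=g\Theta(x)g^{-1}$ for all $g\in G'$ and all $x\in X$. **Lie rack.** A rack is a set $X$ with a binary operation $\triangleright$ such that $x\triangleright(y\triangleright z)=(x\triangleright y)\triangleright(x\triangleright z)$ for all $x,y,z$ and each map $x\triangleright-:X\to X$ is bijective. It is pointed by $e\in X$ if $e\triangleright x=x$ and $x\triangleright e=e$ for all $x$. A Lie rack is a pointed rack $(X,\triangleright,e)$ with $X$ a smooth manifold and $\triangleright$ smooth. **Lie group-rack triple.** A triple $(G,X,\Theta)$ where $G$ is a Lie group, $(X,\triangleright,e)$ is a Lie rack on which $G$ acts smoothly, and $\Theta:X\to G$ is a smooth map with $\Theta(e)=e_G$ such that $x\triangleright y=\Theta(x)\cdot y$ and $\Theta(x\triangleright y)=\Theta(x)\Theta(y)\Theta(x)^{-1}$ for all $x,y\in X$. A relaxed augmented Lie rack $(G,(X,e),\Theta,G')$ has an underlying Lie group-rack triple $(G,X,\Theta)$ with $x\triangleright y:=\Theta(x)\cdot y$. **Morphism of Lie group-rack triples**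 $(G_1,X_1,\Theta_1)\to(G_2,X_2,\Theta_2)$: a pair $(\Phi,\Psi)$ where $\Phi:G_1\to G_2$ is a morphism of Lie groups and $\Psi:X_1\to X_2$ is a smooth map such that $\Psi(e_1)=e_2$ (distinguished points), $\Theta_2(\Psi(x))=\Phi(\Theta_1(x))$ and $\Psi(g\cdot x)=\Phi(g)\cdot\Psi(x)$ for all $g\in G_1$, $x\in X_1$. **Relaxed augmented Leibniz algebra.** A tuple $(\mathfrak{g},V,\theta,\mathfrak{g}')$ where $\mathfrak{g}$ is a Lie algebra acting on a vector space $V$, $\theta:V\to\mathfrak{g}$ is a linear map, and $\mathfrak{g}'\subset\mathfrak{g}$ is a Lie subalgebra containing $\mathrm{Im}(\theta)$, such that $\theta(g\cdot v)=[g,\theta(v)]_{\mathfrak{g}}$ for all $g\in\mathfrak{g}'$ and all $v\in V$. **Lie-Leibniz triple.** A triple $(\mathfrak{g},V,\theta)$ where $(\mathfrak{g},[,]_{\mathfrak g})$ is a Lie algebra, $(V,[,])$ is a Leibniz algebra (a vector space with a bilinear bracket with $[u,[v,w]]=[[u,v],w]+[v,[u,w]]$) which is also a $\mathfrak{g}$-module, and $\theta:V\to\mathfrak{g}$ is a linear map with $[u,v]=\theta(u)\cdot v$ and $\theta([u,v])=[\theta(u),\theta(v)]_{\mathfrak{g}}$ for all $u,v\in V$. A relaxed augmented Leibniz algebra $(\mathfrak{g},V,\theta,\mathfrak{g}')$ gives a Lie-Leibniz triple $(\mathfrak{g},V,\theta)$ with bracket $[u,v]:=\theta(u)\cdot v$.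 **Morphism of Lie-Leibniz triples** $(\mathfrak{g}_1,V_1,\theta_1)\to(\mathfrak{g}_2,V_2,\theta_2)$: a pair $(\varphi,\psi)$ with $\varphi:\mathfrak{g}_1\to\mathfrak{g}_2$ a Lie algebra morphism and $\psi:V_1\to V_2$ a linear map such that $\theta_2(\psi(v))=\varphi(\theta_1(v))$ and $\psi(a\cdot v)=\varphi(a)\cdot\psi(v)$ for all $a\in\mathfrak{g}_1$, $v\in V_1$. *)

(* Defs.v *)
From HB Require Import structures.
From mathcomp Require Import all_boot all_order all_algebra.
From mathcomp Require Import all_classical all_reals all_analysis.

Set Implicit Arguments.
Unset Strict Implicit.
Unset Printing Implicit Defensive.

Import Order.TTheory GRing.Theory Num.Theory.
Import numFieldNormedType.Exports.

Local Open Scope classical_set_scope.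
Local Open Scope ring_scope.

(* [Ck k U f]: f is of class C^k on U, meant for U open and V, W
   finite-dimensional (so that f is C^k as soon as all the partial maps
   x |-> 'd f x v are C^(k-1)).  Only the values of f near U matter. *)
Fixpoint Ck (R : realType) (k : nat) (V W : normedModType R)
    (U : set V) (f : V -> W) : Prop :=
  match k with
  | 0 => {in U, continuous f}
  | k'.+1 => {in U, forall x, differentiable f x} /\
             forall v : V, Ck k' U (fun x => 'd f x v : W)
  end.

Definition smooth_on (R : realType) (V W : normedModType R)
  (U : set V) (f : V -> W) : Prop := forall k : nat, Ck k U f.

(* A homeomorphism between an open set of T and an open set of R^n.  The maps
   are total functions; their values off [dom] and [cod] are junk. *)
Record chart (R : realType) (T : topologicalType) (n : nat) := Chart {
  dom : set T;
  cod : set 'rV[R]_n;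
  coord : T -> 'rV[R]_n;
  param : 'rV[R]_n -> T;
  dom_open : open dom;
  cod_open : open cod;
  coord_cod : forall p, dom p -> cod (coord p);
  param_dom : forall u, cod u -> dom (param u);
  coordK : {in dom, cancel coord param};
  paramK : {in cod, cancel param coord};
  coord_continuous : {in dom, continuous coord};
  param_continuous : {in cod, continuous param}
}.

(* Manifolds without boundary, Hausdorff and second countable, of a fixed
   dimension (possibly 0).  The atlas need not be maximal. *)
HB.mixin Record isManifold (R : realType) M of Topological M := {
  mdim : nat;
  atlas : set (chart R M mdim);
  atlas_cover : forall p : M, exists2 c, atlas c & dom c p;
  atlas_smooth : forall c d, atlas c -> atlas d ->
    smooth_on (cod c `&` param c @^-1` dom d) (coord d \o param c);
  manifold_hausdorff : hausdorff_space M;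
  manifold_second_countable : @second_countable M
}.

#[short(type="manifoldType")]
HB.structure Definition Manifold (R : realType) :=
  { M of isManifold R M & Topological M }.

Arguments mdim {R} M : rename.
Arguments atlas {R} M _ : rename.

(* A smooth map from an open set U of a normed module into a manifold. *)
Definition smooth_into (R : realType) (V : normedModType R)
    (N : manifoldType R) (U : set V) (f : V -> N) : Prop :=
  {in U, continuous f} /\
  forall d, atlas N d -> smooth_on (U `&` f @^-1` dom d) (coord d \o f).

Definition smooth (R : realType) (M N : manifoldType R) (f : M -> N) : Prop :=
  forall c, atlas M c -> smooth_into (cod c) (f \o param c).

(* Smoothness of a map M * N -> P for the product manifold structure, whose
   atlas consists of the products of charts. *)
Definition smooth2 (R : realType) (M N P : manifoldType R)
    (f : M -> N -> P) : Prop :=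
  forall c d, atlas M c -> atlas N d ->
    smooth_into (cod c `*` cod d)
      (fun u : 'rV[R]_(mdim M) * 'rV[R]_(mdim N) =>
         f (param c u.1) (param d u.2)).

Definition chart_at (R : realType) (M : manifoldType R) (p : M) :
    chart R M (mdim M) :=
  s2val (cid2 (atlas_cover p)).

(* The tangent space at p, identified with R^n through the chart [chart_at p]:
   a curve a with a(0) = p represents the vector (coord (chart_at p) \o a)'(0).
   Another choice of charts conjugates everything below by the (invertible)
   differentials of the transition maps. *)
Definition tangent (R : realType) (M : manifoldType R) (p : M) :=
  'rV[R]_(mdim M).

HB.instance Definition _ (R : realType) (M : manifoldType R) (p : M) :=
  NormedModule.on (tangent p).

Definition tmap (R : realType) (M N : manifoldType R) (f : M -> N) (p : M)
    (v : tangent p) : tangent (f p) :=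
  'd (coord (chart_at (f p)) \o f \o param (chart_at p))
     (coord (chart_at p) p) v.
Arguments tmap {R M N} f p v.

(* [velocity a t w]: the curve a has velocity w at time t. *)
Definition velocity (R : realType) (M : manifoldType R) (a : R^o -> M)
    (t : R^o) (w : tangent (a t)) : Prop :=
  is_derive t (1 : R^o) (coord (chart_at (a t)) \o a) w.
Arguments velocity {R M} a t w.

HB.mixin Record isLieGroup (R : realType) G of Manifold R G & Group G := {
  mulg_smooth : smooth2 (fun x y : G => (x * y)%g);
  invg_smooth : smooth (fun x : G => (x^-1)%g)
}.

#[short(type="lieGroupType")]
HB.structure Definition LieGroup (R : realType) :=
  { G of isLieGroup R G & Manifold R G & Group G }.

Definition lie_group_morphism (R : realType) (G H : lieGroupType R)
    (f : G -> H) : Prop :=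
  smooth f /\ {morph f : x y / (x * y)%g >-> (x * y)%g}.

(* A (not necessarily embedded) Lie subgroup of G: a Lie group with an
   injective immersive morphism to G, whose range is the subgroup. *)
Record lieSubgroup (R : realType) (G : lieGroupType R) := LieSubgroup {
  subgroup : lieGroupType R;
  incl : subgroup -> G;
  incl_morphism : lie_group_morphism incl;
  incl_inj : injective incl;
  incl_immersion : forall h : subgroup, injective (tmap incl h)
}.

Definition smooth_action (R : realType) (G : lieGroupType R)
    (X : manifoldType R) (act : G -> X -> X) : Prop :=
  [/\ forall x, act 1%g x = x,
      forall g h x, act (g * h)%g x = act g (act h x) &
      smooth2 act].

(* The vector field X read in the chart c. *)
Definition field_in_chart (R : realType) (M : manifoldType R)
    (c : chart R M (mdim M)) (X : forall p : M, tangent p)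
    (u : 'rV[R]_(mdim M)) : 'rV[R]_(mdim M) :=
  let p := param c u in
  'd (coord c \o param (chart_at p)) (coord (chart_at p) p) (X p).

(* [X, Y] f = X (Y f) - Y (X f), computed at p in the chart [chart_at p]. *)
Definition field_bracket (R : realType) (M : manifoldType R)
    (X Y : forall p : M, tangent p) (p : M) : tangent p :=
  let c := chart_at p in
  let u := coord c p in
  ('d (field_in_chart c Y) u (field_in_chart c X u)
   - 'd (field_in_chart c X) u (field_in_chart c Y u))%R.

(* The carrier of the Lie algebra of G is [tangent (1 : G)]. *)
Definition left_invariant (R : realType) (G : lieGroupType R)
    (a : tangent (1%g : G)) (g : G) : tangent g :=
  tmap (fun h : G => (g * h)%g) 1%g a.

Definition lie_bracket (R : realType) (G : lieGroupType R)
    (a b : tangent (1%g : G)) : tangent (1%g : G) :=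
  field_bracket (left_invariant a) (left_invariant b) 1%g.

Definition sub_lie (R : realType) (G : lieGroupType R) (G' : lieSubgroup G) :
    set (tangent (1%g : G)) :=
  range (tmap (@incl R G G') 1%g).

Record relaxedAugmentedLieRack (R : realType) := RelaxedAugmentedLieRack {
  rack_group : lieGroupType R;
  rack_space : manifoldType R;
  rack_pt : rack_space;
  rack_act : rack_group -> rack_space -> rack_space;
  rack_Theta : rack_space -> rack_group;
  rack_sub : lieSubgroup rack_group;
  rack_actP : smooth_action rack_act;
  rack_act_pt : forall g, rack_act g rack_pt = rack_pt;
  rack_Theta_smooth : smooth rack_Theta;
  rack_Theta_sub : range rack_Theta `<=` range (@incl _ _ rack_sub);
  rack_Theta_pt : rack_Theta rack_pt = 1%g;
  rack_Theta_act : forall g, range (@incl _ _ rack_sub) g ->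
    forall x, rack_Theta (rack_act g x) = (g * rack_Theta x * g^-1)%g
}.

(* A morphism between the underlying Lie group-rack triples; it does not
   involve the subgroups, and the rack products, which are determined by
   x |> y = Theta x . y, do not enter the definition. *)
Record triple_morphism (R : realType) (A1 A2 : relaxedAugmentedLieRack R)
    (Phi : rack_group A1 -> rack_group A2)
    (Psi : rack_space A1 -> rack_space A2) : Prop := TripleMorphism {
  triple_morphism_group : lie_group_morphism Phi;
  triple_morphism_smooth : smooth Psi;
  triple_morphism_pt : Psi (rack_pt A1) = rack_pt A2;
  triple_morphism_Theta :
    forall x, rack_Theta (Psi x) = Phi (rack_Theta x);
  triple_morphism_act :
    forall g x, Psi (rack_act g x) = rack_act (Phi g) (Psi x)
}.

Definition bilinear_map (R : realType) (U V W : lmodType R)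
    (f : U -> V -> W) : Prop :=
  (forall u, linear (f u)) /\ (forall v, linear (f^~ v)).

Record lie_algebra (R : realType) (g : lmodType R) (br : g -> g -> g) : Prop :=
  LieAlgebra {
    lie_bilinear : bilinear_map br;
    lie_alternating : forall a, br a a = 0;
    lie_jacobi : forall a b c,
      br a (br b c) + br b (br c a) + br c (br a b) = 0
  }.

Definition lie_module (R : realType) (g V : lmodType R) (br : g -> g -> g)
    (act : g -> V -> V) : Prop :=
  bilinear_map act /\
  forall a b v, act (br a b) v = act a (act b v) - act b (act a v).

Definition lie_subalgebra (R : realType) (g : lmodType R) (br : g -> g -> g)
    (h : set g) : Prop :=
  [/\ h 0,
      forall (r : R) a b, h a -> h b -> h (r *: a + b) &
      forall a b, h a -> h b -> h (br a b)].

Record relaxed_augmented_leibniz (R : realType) (g V : lmodType R)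
    (br : g -> g -> g) (act : g -> V -> V) (theta : V -> g) (g' : set g) :
    Prop := RelaxedAugmentedLeibniz {
  ral_lie : lie_algebra br;
  ral_module : lie_module br act;
  ral_linear : linear theta;
  ral_subalgebra : lie_subalgebra br g';
  ral_range : range theta `<=` g';
  ral_equivariant :
    forall a, g' a -> forall v, theta (act a v) = br a (theta v)
}.

Definition leibniz_algebra (R : realType) (V : lmodType R)
    (lb : V -> V -> V) : Prop :=
  bilinear_map lb /\
  forall u v w, lb u (lb v w) = lb (lb u v) w + lb v (lb u w).

Record lie_leibniz_triple (R : realType) (g V : lmodType R)
    (br : g -> g -> g) (act : g -> V -> V) (lb : V -> V -> V)
    (theta : V -> g) : Prop := LieLeibnizTriple {
  llt_lie : lie_algebra br;
  llt_leibniz : leibniz_algebra lb;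
  llt_module : lie_module br act;
  llt_linear : linear theta;
  llt_act : forall u v, lb u v = act (theta u) v;
  llt_theta : forall u v, theta (lb u v) = br (theta u) (theta v)
}.

Lemma ral_lie_leibniz_triple (R : realType) (g V : lmodType R)
    (br : g -> g -> g) (act : g -> V -> V) (theta : V -> g) (g' : set g) :
  relaxed_augmented_leibniz br act theta g' ->
  lie_leibniz_triple br act (fun u v => act (theta u) v) theta.
Proof.
case=> brP [[actr actl] actb] thl _ sub eqv.
have eqt u v : theta (act (theta u) v) = br (theta u) (theta v).
  by apply: eqv; apply: sub; exists u.
split=> //; split; first split.
- by move=> u; exact: actr.
- by move=> v r u u' /=; rewrite thl actl.
- by move=> u v w; rewrite eqt actb subrK.
Qed.

(* The morphism of Lie-Leibniz triples (phi, psi), the Leibniz brackets being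
   u, v |-> theta u . v on both sides. *)
Record lie_leibniz_morphism (R : realType)
    (g1 V1 : lmodType R) (br1 : g1 -> g1 -> g1) (act1 : g1 -> V1 -> V1)
    (theta1 : V1 -> g1)
    (g2 V2 : lmodType R) (br2 : g2 -> g2 -> g2) (act2 : g2 -> V2 -> V2)
    (theta2 : V2 -> g2)
    (phi : g1 -> g2) (psi : V1 -> V2) : Prop := LieLeibnizMorphism {
  llm_source :
    lie_leibniz_triple br1 act1 (fun u v => act1 (theta1 u) v) theta1;
  llm_target :
    lie_leibniz_triple br2 act2 (fun u v => act2 (theta2 u) v) theta2;
  llm_linear_lie : linear phi;
  llm_bracket : {morph phi : a b / br1 a b >-> br2 a b};
  llm_linear : linear psi;
  llm_theta : forall v, theta2 (psi v) = phi (theta1 v);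
  llm_act : forall a v, psi (act1 a v) = act2 (phi a) (psi v)
}.

(* The base points agree only up to the equations g . e = e, Theta e = 1,
   Phi 1 = 1 and Psi e1 = e2; no transport is needed since all tangent spaces
   of a manifold are the same R^n, and [chart_at] at equal points is the same
   chart. *)

Definition tangent_lie (R : realType) (A : relaxedAugmentedLieRack R) :=
  tangent (1%g : rack_group A).

Definition tangent_space (R : realType) (A : relaxedAugmentedLieRack R) :=
  tangent (rack_pt A).

HB.instance Definition _ (R : realType) (A : relaxedAugmentedLieRack R) :=
  NormedModule.on (tangent_lie A).
HB.instance Definition _ (R : realType) (A : relaxedAugmentedLieRack R) :=
  NormedModule.on (tangent_space A).

Definition tangent_L (R : realType) (A : relaxedAugmentedLieRack R)
    (g : rack_group A) (v : tangent_space A) : tangent_space A :=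
  tmap (rack_act g) (rack_pt A) v.

(* The differential at 1 of g |-> T_e L_g v, applied to a. *)
Definition tangent_act (R : realType) (A : relaxedAugmentedLieRack R)
    (a : tangent_lie A) (v : tangent_space A) : tangent_space A :=
  let c := chart_at (1%g : rack_group A) in
  'd (fun u => tangent_L (param c u) v) (coord c 1%g) a.

Definition tangent_theta (R : realType) (A : relaxedAugmentedLieRack R)
    (v : tangent_space A) : tangent_lie A :=
  tmap (@rack_Theta R A) (rack_pt A) v.

Definition tangent_bracket (R : realType) (A : relaxedAugmentedLieRack R)
    (a b : tangent_lie A) : tangent_lie A :=
  lie_bracket a b.

Definition tangent_sub (R : realType) (A : relaxedAugmentedLieRack R) :
    set (tangent_lie A) :=
  sub_lie (rack_sub A).

(* Main.v *)
Require Import Defs.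
From HB Require Import structures.
From mathcomp Require Import all_boot all_order all_algebra.
From mathcomp Require Import ring lra.
From mathcomp Require Import all_classical all_reals all_analysis.

Set Implicit Arguments.
Unset Strict Implicit.
Unset Printing Implicit Defensive.

Import Order.TTheory GRing.Theory Num.Theory.
Import numFieldNormedType.Exports.
(* [coord] and [dom] below are those of a chart. *)
Import Defs.

Local Open Scope classical_set_scope.
Local Open Scope ring_scope.

(** Why the theorem holds.

    Since [e] is fixed by [G], the maps [T_e L_g] form a smooth linear
    representation of [G] on [T_e X] ([isotropy_rep]), and the module
    structure of the statement is its differential at the unit; the
    description by curves is the chain rule ([is_derive_tangent_L]). For a smooth
    representation [rho], differentiating [rho (x * y) v = rho x (rho y v)]
    first in [y] and then in [x] expresses [drho a (drho b v)] as a second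
    derivative of [rho], which is symmetric in [a] and [b], plus [drho] of the
    derivative along [a] of the left invariant field of [b]; antisymmetrizing
    gives [drho [a, b] = drho a drho b - drho b drho a] ([rep_diff_module]).

    The adjoint representation is the isotropy representation of the
    conjugation action at the unit. Differentiating [(g * h * g^-1) * g = g *
    h] twice shows that its differential is the bracket of left invariant
    fields ([rep_diff_Ad]), so that the Jacobi identity is the module identity
    for [Ad].

    All compatibilities with morphisms are instances of one fact: a linear map
    that intertwines two representations pulled back to a common Lie group
    also intertwines their differentials ([rep_diff_intertwine]). For the
    adjoint representations it says that the differential of a morphism of Lie
    groups respects brackets; for the isotropy representations of two racks it
    is the equivariance of [T Psi]; for the isotropy and the adjoint
    representation, both restricted to [G'], it is [theta (a . v) = [a, theta
    v]] for [a] in [g'], because [Theta (g . x) = g * Theta x * g^-1] says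
    that [Theta] intertwines the actions of [G'].

    It remains to see that [theta] takes values in [g']
    ([tangent_in_subgroup]). This is delicate because [G'] is only an immersed
    subgroup: [Theta] factors through the inclusion of [G'] as a map of sets,
    but nothing says beforehand that the factorization is continuous. As
    [G'] is second countable it is a countable union of compact sets; by
    Baire's theorem every neighbourhood of [e] contains an open set that
    [Theta] maps into the image of a single one of them, on which the
    inclusion is a homeomorphism onto its image. There the factorization is
    continuous, and an immersion forces the derivative of the composite, left
    translated to the unit, into [g'] ([diff_through_immersion]). Hence the
    translated derivative of [Theta] lies in the closed subspace [g'] at
    points arbitrarily close to [e], and therefore at [e] by continuity.
    Baire's theorem thus replaces the inverse function theorem. *)

(** * Neighbourhoods and products *)

Lemma near_eq_continuous (S T : topologicalType) (f g : S -> T) x :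
  {near x, f =1 g} -> {for x, continuous f} -> {for x, continuous g}.
Proof.
move=> fg cf; have E : f x = g x := nbhs_singleton fg.
rewrite /prop_for /continuous_at -E; apply: cvg_trans cf.
by apply: near_eq_cvg; apply: filterS fg => y ->.
Qed.

Lemma near_prod (S T : topologicalType) (x : S) (y : T) (P : S * T -> Prop) :
  (\forall z \near (x, y), P z) ->
  \forall u \near x, \forall w \near y, P (u, w).
Proof.
move=> [[A B] /= [xA yB] AB]; apply: filterS xA => u Au.
by apply: filterS yB => w Bw; exact: AB.
Qed.

Lemma near_prod_l (S T : topologicalType) (x : S) (y : T) (P : S * T -> Prop) :
  (\forall z \near (x, y), P z) -> \forall u \near x, P (u, y).
Proof. by move=> /near_prod; apply: filterS => u /nbhs_singleton. Qed.

Lemma near_prod_r (S T : topologicalType) (x : S) (y : T) (P : S * T -> Prop) :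
  (\forall z \near (x, y), P z) -> \forall w \near y, P (x, w).
Proof. by move=> /near_prod/nbhs_singleton. Qed.

Lemma open_setX (S T : topologicalType) (A : set S) (B : set T) :
  open A -> open B -> open (A `*` B).
Proof.
rewrite !openE => oA oB [x y] [/= Ax By].
by exists (A, B) => //=; split; [exact: oA|exact: oB].
Qed.

Lemma open_near (V : topologicalType) (U : set V) (P : V -> Prop) x :
  open U -> U x -> (forall y, U y -> P y) -> \forall y \near x, P y.
Proof.
by move=> oU Ux h; apply: filterS h _; apply: open_nbhs_nbhs.
Qed.

(** * Differentials *)

Section Differentials.
Context {R : realType}.
Implicit Types V W Z : normedModType R.

Lemma diff_eps V W (f : V -> W) x : differentiable f x ->
  forall e : R, 0 < e ->
  \forall y \near x, `|f y - f x - 'd f x (y - x)| <= e * `|y - x|.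
Proof.
move=> /diff_locallyP [_ /eqaddoP h] e e0.
have : \forall y \near (0 : V),
  `|(f \o shift x) y - (cst (f x) + 'd f x) y| <= e * `|y| := h _ e0.
rewrite (near_shift x 0) => hh.
apply: filterS hh => y /=.
by rewrite sub0r subrK opprD addrA.
Qed.

Lemma is_diff_eps V W (f : V -> W) (df : {linear V -> W}) x :
  continuous df ->
  (forall e : R, 0 < e ->
    \forall y \near x, `|f y - f x - df (y - x)| <= e * `|y - x|) ->
  is_diff x f df.
Proof.
move=> dfc h.
have H : f \o shift x = cst (f x) + df +o_ 0 id.
  apply/eqaddoP => e e0; have := h _ e0; rewrite (near_shift 0 x) => hh.
  have : \forall y \near (0 : V),
    `|(f \o shift x) y - (cst (f x) + df) y| <= e * `|y|.
    apply: filterS hh => y /=.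
    by rewrite subr0 addrK opprD addrA.
  by [].
have E := diff_unique dfc H.
apply: DiffDef => //; apply/diff_locallyP; rewrite E; split=> //.
Qed.

Lemma near_eq_is_diff V W (f g : V -> W) x :
  {near x, f =1 g} -> differentiable f x -> is_diff x g ('d f x).
Proof.
move=> fg df; apply: is_diff_eps; first exact: diff_continuous.
move=> e e0; apply: filterS2 (fg) (diff_eps df e0) => y fgy.
by rewrite fgy (nbhs_singleton fg).
Qed.

Lemma near_eq_diff V W (f g : V -> W) x :
  {near x, f =1 g} -> differentiable f x -> 'd g x = 'd f x :> (V -> W).
Proof. by move=> fg df; have [] := near_eq_is_diff fg df. Qed.

Lemma near_eq_differentiable V W (f g : V -> W) x :
  {near x, f =1 g} -> differentiable f x -> differentiable g x.
Proof. by move=> fg df; have [] := near_eq_is_diff fg df. Qed.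

Lemma diff_near_id V (f : V -> V) x v : {near x, f =1 id} -> 'd f x v = v.
Proof.
move=> fI; have dI : is_diff x (id : V -> V) id := is_diff_id x.
have E : 'd (id : V -> V) x = id :> (V -> V) by case: dI.
have dI' : differentiable (id : V -> V) x by case: dI.
have -> : 'd f x v = 'd (id : V -> V) x v.
  by apply: (congr1 (@^~ v)); apply: near_eq_diff => //; apply: filterS fI.
by rewrite E.
Qed.

Lemma diff_addE V W (f g : V -> W) x v :
  differentiable f x -> differentiable g x ->
  'd (fun y => f y + g y) x v = 'd f x v + 'd g x v.
Proof. by move=> df dg; have := congr1 (@^~ v) (diffD df dg). Qed.

Lemma diff_compE V W Z (f : V -> Z) (g : Z -> W) x v :
  differentiable f x -> differentiable g (f x) ->
  'd (fun y => g (f y)) x v = 'd g (f x) ('d f x v).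
Proof. by move=> df dg; rewrite -[fun y => _]/(g \o f) diff_comp. Qed.

Lemma is_diff_scale V W (a : V -> R^o) (g : V -> W) x :
  differentiable a x -> differentiable g x ->
  is_diff x (fun y => a y *: g y)
    (fun v => 'd a x v *: g x + a x *: 'd g x v).
Proof.
move=> da dg.
have bil : bilinear_for
    (GRing.Scale.Law.clone _ _ *:%R _) (GRing.Scale.Law.clone _ _ *:%R _)
    (fun (k : R^o) (w : W) => k *: w).
  split=> [w|k] r u v /=; first by rewrite scalerDl -scalerA.
  by rewrite scalerDr !scalerA mulrC.
pose M := bilinear_isBilinear.Build R R^o W W _ _ _ bil.
pose L : {bilinear R^o -> W -> W} := HB.pack (fun (k : R^o) (w : W) => k *: w) M.
have cL : continuous (fun p : R^o * W => L p.1 p.2).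
  by move=> p; apply: scale_continuous.
have dp := differentiable_pair da dg.
have dL := differentiable_bilin (a x, g x) cL.
apply: DiffDef; first exact: (differentiable_comp dp dL).
have := diff_comp dp dL; rewrite diff_bilin // diff_pair //= => E.
by rewrite [LHS]E; apply/funext => v /=; rewrite addrC.
Qed.

Lemma is_diff_lin_comp V W Z (L : {linear W -> Z}) (f : V -> W) x :
  continuous L -> differentiable f x ->
  is_diff x (L \o f) (L \o 'd f x).
Proof.
move=> Lc df; have dL := linear_differentiable (f x) Lc.
by apply: DiffDef; [exact: differentiable_comp|rewrite diff_comp// diff_lin].
Qed.

Lemma is_diff_pairl V W (x : V) (y : W) :
  is_diff x (fun u => (u, y) : V * W) (fun v => (v, 0)).
Proof. exact: (is_diff_pair (is_diff_id x) (is_diff_cst y x)). Qed.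

Lemma is_diff_pairr V W (x : V) (y : W) :
  is_diff y (fun u => (x, u) : V * W) (fun v => (0, v)).
Proof. exact: (is_diff_pair (is_diff_cst x y) (is_diff_id y)). Qed.

Lemma diff_pair_cst V W Z (f : V -> W) (z : Z) x v : differentiable f x ->
  'd (fun y => (f y, z) : W * Z) x v = ('d f x v, 0).
Proof.
move=> df; have E := diff_pair df (differentiable_cst z x).
apply: etrans (congr1 (fun h => h v) E) _; congr pair.
exact: (congr1 (fun h => h v) (@diff_cst _ V Z z x)).
Qed.

Lemma diff_partial_l V W Z (f : V * W -> Z) x y v :
  differentiable f (x, y) ->
  'd (fun u => f (u, y)) x v = 'd f (x, y) (v, 0).
Proof.
move=> df.
have dp : is_diff x (fun u => (u, y) : (V * W)%type) (fun v => (v, 0)).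
  exact: is_diff_pairl.
rewrite -[fun u => f (u, y)]/(f \o (fun u => (u, y))).
by rewrite (diff_comp (@ex_diff _ _ _ _ _ _ _ dp) df) /= diff_val.
Qed.

Lemma diff_partial_r V W Z (f : V * W -> Z) x y w :
  differentiable f (x, y) ->
  'd (fun u => f (x, u)) y w = 'd f (x, y) (0, w).
Proof.
move=> df.
have dp : is_diff y (fun u => (x, u) : (V * W)%type) (fun v => (0, v)).
  exact: is_diff_pairr.
rewrite -[fun u => f (x, u)]/(f \o (fun u => (x, u))).
by rewrite (diff_comp (@ex_diff _ _ _ _ _ _ _ dp) df) /= diff_val.
Qed.

Lemma diff_sumE V W n (f : 'I_n -> V -> W) x v :
  (forall i, differentiable (f i) x) ->
  differentiable (fun y => \sum_(i < n) f i y) x /\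
  'd (fun y => \sum_(i < n) f i y) x v = \sum_(i < n) 'd (f i) x v.
Proof.
elim: n f => [|n IH] f df.
  rewrite (_ : (fun y => _) = cst 0); last first.
    by apply/funext => y; rewrite big_ord0.
  by split; [exact: differentiable_cst|rewrite diff_cst big_ord0].
have [d1 e1] := IH (fun i => f (widen_ord (leqnSn n) i)) (fun i => df _).
rewrite (_ : (fun y => _) =
    fun y => \sum_(i < n) f (widen_ord (leqnSn n) i) y + f ord_max y); last first.
  by apply/funext => y; rewrite big_ord_recr.
split; first exact: differentiableD d1 (df _).
by rewrite (diff_addE v d1 (df _)) e1 big_ord_recr.
Qed.

End Differentials.

(** * Bases in finite-dimensional normed modules *)

(** Row vectors and products of spaces of row vectors both occur as domains;
    all that is needed of their finite dimension is a continuous system of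
    coordinates. *)
Record fin_basis (R : realType) (Z : normedModType R) := FinBasis {
  fb_dim : nat;
  fb_vec : 'I_fb_dim -> Z;
  fb_coord : 'I_fb_dim -> {linear Z -> R^o};
  fb_cont : forall i, continuous (fb_coord i);
  fb_sum : forall z, z = \sum_(i < fb_dim) fb_coord i z *: fb_vec i
}.

Section FiniteDimension.
Context {R : realType}.
Implicit Types V W Z : normedModType R.

Definition rV_fin_basis n : fin_basis ('rV[R]_n : normedModType R).
Proof.
have lin (i : 'I_n) : linear (fun u : 'rV[R]_n => u 0 i : R^o).
  by move=> a u v; rewrite !mxE.
pose M i := GRing.isLinear.Build _ _ _ _ _ (lin i).
pose L i : {linear 'rV[R]_n -> R^o} :=
  HB.pack (fun u : 'rV[R]_n => u 0 i : R^o) (M i).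
apply: (@FinBasis _ _ n (fun i => delta_mx 0 i) L) => [i|z].
  exact: matrix_normedtype.coord_continuous.
by rewrite [LHS]row_sum_delta.
Defined.

Definition prod_fin_basis (V W : normedModType R) :
  fin_basis V -> fin_basis W -> fin_basis (V * W : normedModType R)%type.
Proof.
move=> A B.
have linA (i : 'I_(fb_dim A)) : linear (fun u : V * W => fb_coord i u.1).
  by move=> a u v; rewrite linearP.
have linB (i : 'I_(fb_dim B)) : linear (fun u : V * W => fb_coord i u.2).
  by move=> a u v; rewrite linearP.
pose MA i := GRing.isLinear.Build _ _ _ _ _ (linA i).
pose MB i := GRing.isLinear.Build _ _ _ _ _ (linB i).
pose LA i : {linear (V * W)%type -> R^o} :=
  HB.pack (fun u : V * W => fb_coord i u.1) (MA i).
pose LB i : {linear (V * W)%type -> R^o} :=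
  HB.pack (fun u : V * W => fb_coord i u.2) (MB i).
pose e (i : 'I_(fb_dim A + fb_dim B)) : (V * W)%type :=
  match fintype.split i with inl j => (fb_vec j, 0) | inr j => (0, fb_vec j) end.
pose L (i : 'I_(fb_dim A + fb_dim B)) : {linear (V * W)%type -> R^o} :=
  match fintype.split i with inl j => LA j | inr j => LB j end.
apply: (@FinBasis _ _ _ e L) => [i|z].
  rewrite /L; case: (fintype.split i) => j x.
    by apply: continuous_comp; [exact: cvg_fst|exact: fb_cont].
  by apply: continuous_comp; [exact: cvg_snd|exact: fb_cont].
rewrite big_split_ord /=.
rewrite (eq_bigr (fun j => (fb_coord j z.1 *: fb_vec j, 0) : (V * W)%type));
  last first.
  move=> j _; rewrite /L /e.
  rewrite (_ : fintype.split (lshift _ j) = inl j) ?(unsplitK (inl j)) //=.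
  by congr pair; rewrite scaler0.
rewrite (eq_bigr (fun j => (0, fb_coord j z.2 *: fb_vec j) : (V * W)%type));
  last first.
  move=> j _; rewrite /L /e.
  rewrite (_ : fintype.split (rshift _ j) = inr j) ?(unsplitK (inr j)) //=.
  by congr pair; rewrite scaler0.
rewrite [LHS]surjective_pairing {1}(fb_sum A z.1) {1}(fb_sum B z.2).
have E1 n (f : 'I_n -> V) :
    \sum_(j < n) ((f j, 0) : (V * W)%type) = (\sum_(j < n) f j, 0).
  by elim/big_rec2 : _ => // j x y _ ->; congr pair; rewrite addr0.
have E2 n (f : 'I_n -> W) :
    \sum_(j < n) ((0, f j) : (V * W)%type) = (0, \sum_(j < n) f j).
  by elim/big_rec2 : _ => // j x y _ ->; congr pair; rewrite addr0.
by rewrite E1 E2; congr pair; rewrite ?addr0 ?add0r.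
Defined.

End FiniteDimension.

(** * Maps of class C^k *)

Section Ck.
Context {R : realType}.
Implicit Types (V W Z : normedModType R) (k : nat).

Lemma Ck_sub V W k (U U' : set V) (f : V -> W) :
  U' `<=` U -> Ck k U f -> Ck k U' f.
Proof.
move=> UU; elim: k f => [|k IH] f /=.
  by move=> h x /set_mem/UU/mem_set; apply: h.
move=> [h1 h2]; split=> [x /set_mem/UU/mem_set|v]; first exact: h1.
exact: IH.
Qed.

Lemma Ck_ext V W k (U : set V) (f g : V -> W) : open U ->
  (forall x, U x -> f x = g x) -> Ck k U f -> Ck k U g.
Proof.
move=> oU; elim: k f g => [|k IH] f g fg /=.
  move=> h x xU; apply: near_eq_continuous (h x xU).
  by apply: open_near (set_mem xU) _.
move=> [h1 h2]; split=> [x xU|v].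
  apply: near_eq_differentiable (h1 _ xU).
  by apply: open_near (set_mem xU) _.
apply: IH (h2 v) => x Ux; rewrite (@near_eq_diff _ _ _ f g x) //.
  by apply: open_near Ux _.
by apply: h1; apply: mem_set.
Qed.

Lemma CkW V W k (U : set V) (f : V -> W) : Ck k.+1 U f -> Ck k U f.
Proof.
elim: k f => [|k IH] f; last by move=> [h1 h2]; split=> // v; apply/IH/h2.
by move=> [h1 _] x xU; apply: differentiable_continuous; apply: h1.
Qed.

Lemma Ck_cst V W k (U : set V) (a : W) : Ck k U (fun=> a).
Proof.
elim: k a => [|k IH] a /=; first by move=> x _; apply: cvg_cst.
split=> [x _|v]; first exact: differentiable_cst.
rewrite (_ : (fun x => _) = fun=> 0) //.
by apply/funext => x; rewrite diff_cst.
Qed.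

Lemma Ck_linear V W k (U : set V) (L : {linear V -> W}) :
  continuous L -> Ck k U L.
Proof.
move=> Lc; case: k => [|k] /=; first by move=> x _; apply: Lc.
split=> [x _|v]; first exact: linear_differentiable.
rewrite (_ : (fun x => _) = fun=> L v); first exact: Ck_cst.
by apply/funext => x; rewrite diff_lin.
Qed.

Lemma Ck_lin_comp V W Z k (U : set V) (L : {linear W -> Z}) (f : V -> W) :
  open U -> continuous L -> Ck k U f -> Ck k U (L \o f).
Proof.
move=> oU Lc; elim: k f => [|k IH] f /=.
  move=> h x xU; apply: continuous_comp; [exact: h|exact: Lc].
move=> [h1 h2]; split=> [x xU|v].
  by have [] := is_diff_lin_comp Lc (h1 _ xU).
apply: Ck_ext (IH _ (h2 v)) => // x Ux /=.
by have [_ ->] := is_diff_lin_comp Lc (h1 _ (mem_set Ux)).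
Qed.

Lemma Ck_add V W k (U : set V) (f g : V -> W) : open U ->
  Ck k U f -> Ck k U g -> Ck k U (fun x => f x + g x).
Proof.
move=> oU; elim: k f g => [|k IH] f g /=.
  by move=> hf hg x xU; apply: cvgD; [exact: hf|exact: hg].
move=> [f1 f2] [g1 g2]; split=> [x xU|v].
  by apply: differentiableD; [exact: f1|exact: g1].
apply: Ck_ext (IH _ _ (f2 v) (g2 v)) => // x Ux /=.
exact: esym (diff_addE v (f1 _ (mem_set Ux)) (g1 _ (mem_set Ux))).
Qed.

Lemma Ck_sum V W k (U : set V) n (f : 'I_n -> V -> W) : open U ->
  (forall i, Ck k U (f i)) -> Ck k U (fun x => \sum_(i < n) f i x).
Proof.
move=> oU; elim: n f => [|n IH] f fC.
  rewrite (_ : (fun x => _) = fun=> 0); first exact: Ck_cst.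
  by apply/funext => x; rewrite big_ord0.
rewrite (_ : (fun x => _) =
    fun x => \sum_(i < n) f (widen_ord (leqnSn n) i) x + f ord_max x).
  by apply: Ck_add => //; apply: IH.
by apply/funext => x; rewrite big_ord_recr.
Qed.

Lemma Ck_scale V W k (U : set V) (a : V -> R^o) (g : V -> W) : open U ->
  Ck k U a -> Ck k U g -> Ck k U (fun x => a x *: g x).
Proof.
move=> oU; elim: k a g => [|k IH] a g.
  by move=> ha hg x xU; apply: cvgZ; [exact: ha|exact: hg].
move=> aC gC; have aC' := CkW aC; have gC' := CkW gC.
case: aC gC => [a1 a2] [g1 g2]; split=> [x xU|v].
  by have [] := is_diff_scale (a1 _ xU) (g1 _ xU).
have h := Ck_add oU (IH _ _ (a2 v) gC') (IH _ _ aC' (g2 v)).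
apply: Ck_ext h => // x Ux.
by have [_ ->] := is_diff_scale (a1 _ (mem_set Ux)) (g1 _ (mem_set Ux)).
Qed.

Lemma Ck_pair V W Z k (U : set V) (f : V -> W) (g : V -> Z) : open U ->
  Ck k U f -> Ck k U g -> Ck k U (fun x => (f x, g x) : W * Z).
Proof.
move=> oU; elim: k f g => [|k IH] f g /=.
  by move=> hf hg x xU; apply: cvg_pair; [exact: hf|exact: hg].
move=> [f1 f2] [g1 g2]; split=> [x xU|v].
  by apply: differentiable_pair; [exact: f1|exact: g1].
apply: Ck_ext (IH _ _ (f2 v) (g2 v)) => // x Ux /=.
by rewrite (diff_pair (f1 _ (mem_set Ux)) (g1 _ (mem_set Ux))).
Qed.

(** Expanding [x |-> 'd g (f x) ('d f x v)] in a basis of the intermediate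
    space turns it into a sum of products of maps of class C^(k-1), on which
    the induction proceeds. *)
Lemma Ck_comp V W Z k (U : set V) (U' : set Z) (f : V -> Z) (g : Z -> W) :
  fin_basis Z -> open U -> (forall x, U x -> U' (f x)) ->
  Ck k U f -> Ck k U' g -> Ck k U (g \o f).
Proof.
move=> B oU fU; elim: k g => [|k IH] g.
  move=> hf hg x xU; apply: continuous_comp; first exact: hf.
  by apply: hg; apply/mem_set/fU/set_mem.
move=> fC [g1 g2]; have fC' := CkW fC; case: fC => [f1 f2].
have gd x : U x -> differentiable g (f x).
  by move=> Ux; apply/g1/mem_set/fU.
split=> [x xU|v].
  by apply: differentiable_comp; [exact: f1|exact/gd/set_mem].
have h : Ck k U (fun x => \sum_(i < fb_dim B)
    (fb_coord i ('d f x v) : R^o) *: ('d g (f x) (fb_vec i) : W)).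
  apply: Ck_sum => // i; apply: Ck_scale => //.
    have Lc : continuous (fb_coord i) by exact: fb_cont.
    exact: (Ck_lin_comp oU Lc (f2 v)).
  exact: (IH (fun y => 'd g y (fb_vec i)) fC' (g2 _)).
apply: Ck_ext h => // x Ux.
rewrite (diff_comp (f1 _ (mem_set Ux)) (gd _ Ux)).
rewrite [in RHS]/= [in RHS](fb_sum B ('d f x v)) linear_sum.
by apply: eq_bigr => i _; rewrite linearZ.
Qed.

Lemma fin_linear_continuous V W (L : {linear V -> W}) :
  fin_basis V -> continuous L.
Proof.
move=> B; have E : (L : V -> W) =
    fun z => \sum_(i < fb_dim B) (fb_coord i z : R^o) *: L (fb_vec i).
  apply/funext => z; rewrite [in LHS](fb_sum B z) linear_sum.
  by apply: eq_bigr => i _; rewrite linearZ.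
have h : Ck 0 setT (fun z =>
    \sum_(i < fb_dim B) (fb_coord i z : R^o) *: L (fb_vec i)).
  apply: Ck_sum => [|i]; first exact: openT.
  apply: Ck_scale; [exact: openT|exact/Ck_linear/fb_cont|exact: Ck_cst].
by rewrite E => z; apply: h; rewrite in_setT.
Qed.

Lemma is_diff_linear_comp V W Z (L : W -> Z) (f : V -> W) x :
  linear L -> fin_basis W -> differentiable f x ->
  is_diff x (fun y => L (f y)) (fun v => L ('d f x v)).
Proof.
move=> lin B df.
pose LL : {linear W -> Z} := HB.pack L (GRing.isLinear.Build _ _ _ _ _ lin).
have [d e] := is_diff_lin_comp (@fin_linear_continuous _ _ LL B) df.
by apply: DiffDef; [exact: d|exact: e].
Qed.

End Ck.

(** * Germs of smooth maps *)

Section SmoothNear.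
Context {R : realType}.
Implicit Types (V W Z : normedModType R).

Definition smooth_near V W (f : V -> W) (x : V) :=
  exists2 U : set V, open_nbhs x U & smooth_on U f.

Lemma smooth_near_diff V W (f : V -> W) x :
  smooth_near f x -> \forall y \near x, differentiable f y.
Proof.
move=> [U [oU Ux] fU]; apply: (open_near oU Ux) => y Uy.
by have [h _] := fU 1%N; apply/h/mem_set.
Qed.

Lemma smooth_near_differentiable V W (f : V -> W) x :
  smooth_near f x -> differentiable f x.
Proof. by move=> /smooth_near_diff/nbhs_singleton. Qed.

Lemma smooth_near_continuous V W (f : V -> W) x :
  smooth_near f x -> {for x, continuous f}.
Proof. by move=> /smooth_near_differentiable/differentiable_continuous. Qed.

Lemma smooth_near_ext V W (f g : V -> W) x :
  {near x, f =1 g} -> smooth_near f x -> smooth_near g x.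
Proof.
rewrite -[{near _, _}]/(nbhs x [set y | f y = g y]) nbhsE => -[A [oA Ax] fg].
move=> [U [oU Ux] fU]; exists (U `&` A); first by split; [exact: openI|].
move=> k; have h : Ck k (U `&` A) f by apply: Ck_sub (fU k); exact: subIsetl.
by apply: Ck_ext h; [exact: openI|move=> y [_ Ay]; exact: fg].
Qed.

Lemma smooth_near_d V W (f : V -> W) x v :
  smooth_near f x -> smooth_near (fun y => 'd f y v : W) x.
Proof.
by move=> [U oU fU]; exists U => // k; have [_ h] := fU k.+1; apply: h.
Qed.

Lemma smooth_near_cst V W (w : W) (x : V) : smooth_near (fun=> w) x.
Proof.
by exists setT => [|k]; [split=> //; exact: openT|exact: Ck_cst].
Qed.

Lemma smooth_near_lin V W (L : {linear V -> W}) x :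
  continuous L -> smooth_near L x.
Proof.
by move=> Lc; exists setT => [|k]; [split=> //; exact: openT|exact: Ck_linear].
Qed.

Lemma smooth_near_id V (x : V) : smooth_near id x.
Proof. by apply: (@smooth_near_lin _ _ idfun) => y; exact: cvg_id. Qed.

Lemma smooth_near_fst V W (z : V * W) : smooth_near (fst : V * W -> V) z.
Proof.
have lin : linear (fst : V * W -> V) by [].
pose L : {linear (V * W)%type -> V} :=
  HB.pack (fst : V * W -> V) (GRing.isLinear.Build _ _ _ _ _ lin).
by apply: (@smooth_near_lin _ _ L) => u; exact: cvg_fst.
Qed.

Lemma smooth_near_snd V W (z : V * W) : smooth_near (snd : V * W -> W) z.
Proof.
have lin : linear (snd : V * W -> W) by [].
pose L : {linear (V * W)%type -> W} :=
  HB.pack (snd : V * W -> W) (GRing.isLinear.Build _ _ _ _ _ lin).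
by apply: (@smooth_near_lin _ _ L) => u; exact: cvg_snd.
Qed.

Lemma smooth_near_pair V W Z (f : V -> W) (g : V -> Z) x :
  smooth_near f x -> smooth_near g x ->
  smooth_near (fun y => (f y, g y) : W * Z) x.
Proof.
move=> [U [oU Ux] fU] [A [oA Ax] gA]; exists (U `&` A).
  by split; [exact: openI|].
move=> k; apply: Ck_pair; first exact: openI.
  by apply: Ck_sub (fU k); exact: subIsetl.
by apply: Ck_sub (gA k); exact: subIsetr.
Qed.

Lemma smooth_near_comp V Z W (f : V -> Z) (g : Z -> W) x :
  fin_basis Z -> smooth_near f x -> smooth_near g (f x) ->
  smooth_near (g \o f) x.
Proof.
move=> B sf [A [oA Ax] gA]; have cf := smooth_near_continuous sf.
case: sf => U [oU Ux] fU.
have : nbhs x (f @^-1` A) by apply: cf; apply: open_nbhs_nbhs.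
rewrite nbhsE => -[N [oN Nx] NA]; exists (U `&` N).
  by split; [exact: openI|].
move=> k; apply: (Ck_comp B (U' := A)) (gA k); first exact: openI.
  by move=> y [_ /NA].
by apply: Ck_sub (fU k); exact: subIsetl.
Qed.

(** The product rule for the evaluation of a moving differential at a moving
    vector; a basis of the source makes it a finite sum of products of scalar
    and vector-valued maps. *)
Lemma diff_apply V W Z (f : Z -> W) (h : V -> Z) (w : V -> Z) x v :
  fin_basis Z -> smooth_near f (h x) ->
  differentiable h x -> differentiable w x ->
  differentiable (fun y => 'd f (h y) (w y) : W) x /\
  'd (fun y => 'd f (h y) (w y) : W) x v =
    'd (fun y => 'd f y (w x) : W) (h x) ('d h x v) + 'd f (h x) ('d w x v).
Proof.
move=> B sf dh dw.
have E : (fun y => 'd f (h y) (w y) : W) = fun y => \sum_(i < fb_dim B)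
    (fb_coord i (w y) : R^o) *: ('d f (h y) (fb_vec i) : W).
  apply/funext => y; rewrite [in LHS](fb_sum B (w y)) linear_sum.
  by apply: eq_bigr => i _; rewrite linearZ.
have sd i := smooth_near_differentiable (smooth_near_d (@fb_vec _ _ B i) sf).
have dc i := is_diff_lin_comp (@fb_cont _ _ B i) dw.
have dd i := is_diff_scale (@ex_diff _ _ _ _ _ _ _ (dc i))
  (differentiable_comp dh (sd i)).
rewrite E; have [d1 e1] := diff_sumE v (fun i => @ex_diff _ _ _ _ _ _ _ (dd i)).
split=> //; rewrite e1.
have {e1 d1}-> : 'd f (h x) ('d w x v) = \sum_(i < fb_dim B)
    fb_coord i ('d w x v) *: ('d f (h x) (fb_vec i) : W).
  rewrite [in LHS](fb_sum B ('d w x v)) linear_sum.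
  by apply: eq_bigr => i _; rewrite linearZ.
have -> : 'd (fun y => 'd f y (w x) : W) (h x) ('d h x v) =
  \sum_(i < fb_dim B)
    fb_coord i (w x) *: ('d (fun y => 'd f y (fb_vec i) : W) (h x) ('d h x v)).
  have -> : (fun y => 'd f y (w x) : W) = fun y => \sum_(i < fb_dim B)
      ( *:%R (fb_coord i (w x)) \o (fun y => 'd f y (fb_vec i) : W)) y.
    apply/funext => y; rewrite [in LHS](fb_sum B (w x)) linear_sum.
    by apply: eq_bigr => i _; rewrite linearZ.
  have di i := is_diffZ (fb_coord i (w x)) (differentiableP (sd i)).
  have [_ ->] := diff_sumE ('d h x v) (fun i => @ex_diff _ _ _ _ _ _ _ (di i)).
  by apply: eq_bigr => i _; have [_ ->] := di i.
rewrite -big_split /=; apply: eq_bigr => i _.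
have [_ ->] := dd i; have [_ ->] := dc i; rewrite addrC.
by congr (_ *: _ + _); rewrite (diff_comp dh (sd i)).
Qed.

(** The mean value theorem in the direction [a], and then differentiability of
    [y |-> 'd f y a] at [x], estimate the second difference of [f]; as the
    latter is symmetric in [a] and [b], so is the second derivative. *)
Lemma second_difference V (f : V -> R^o) x a b (e : R) :
  smooth_near f x -> 0 < e ->
  exists2 d : R, 0 < d & forall h : R, 0 < h < d ->
    `|f (x + h *: a + h *: b) - f (x + h *: a) - f (x + h *: b) + f x
      - h ^+ 2 * 'd (fun y => 'd f y a : R^o) x b| <= e * h ^+ 2.
Proof.
move=> sf e0; pose F : V -> R^o := fun y => 'd f y a.
(* [M * h] dominates the two displacements from [x] at which [F] is estimated;
   the summand [1] makes [M] positive. *)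
pose M : R := (`|a| + `|b|) + (`|a| + `|b|) + 1.
have M0 : 0 < M by rewrite ltr_wpDl // !addr_ge0.
have eM0 : 0 < e / M by rewrite divr_gt0.
have dF := smooth_near_differentiable (smooth_near_d a sf).
have [r /= r0 hr] : exists2 r : R, 0 < r & forall y, `|y - x| < r ->
    differentiable f y /\ `|F y - F x - 'd F x (y - x)| <= e / M * `|y - x|.
  have /nbhs_ballP [r r0 hr] : \forall y \near x, differentiable f y /\
      `|F y - F x - 'd F x (y - x)| <= e / M * `|y - x|.
    by apply: filterS2 (smooth_near_diff sf) (diff_eps dF eM0).
  by exists r => // y yx; apply: hr; rewrite -ball_normE /= distrC.
exists (r / M); first by rewrite divr_gt0.
move=> h /andP[h0]; rewrite ltr_pdivlMr // => hM.
have bnd (s t : R) : 0 <= s <= h -> 0 <= t <= h ->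
    `|x + s *: a + t *: b - x| <= h * (`|a| + `|b|).
  move=> /andP[s0 sh] /andP[t0 th].
  rewrite addrAC [x + _]addrC addrK (le_trans (ler_normD _ _)) // !normrZ mulrDr.
  by rewrite !ger0_norm // lerD // ler_wpM2r.
have lt_r (s t : R) : 0 <= s <= h -> 0 <= t <= h ->
    `|x + s *: a + t *: b - x| < r.
  move=> sh th; apply: le_lt_trans (bnd _ _ sh th) (le_lt_trans _ hM).
  rewrite ler_wpM2l ?(ltW h0) // /M; have := normr_ge0 a; have := normr_ge0 b; lra.
have h00 : 0 <= (0 : R) <= h by apply/andP; split; lra.
have hhh : 0 <= h <= h by apply/andP; split; lra.
pose g (s : R^o) : R^o := f (x + s *: a + h *: b) - f (x + s *: a + 0 *: b).
have dline (s t : R) : 0 <= s <= h -> 0 <= t <= h ->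
    is_derive (s : R^o) (1 : R^o) (fun u : R^o => f (x + u *: a + t *: b))
      (F (x + s *: a + t *: b)).
  move=> sh th; have [df _] := hr _ (lt_r _ _ sh th).
  have dl : is_diff (s : R^o) (fun u : R^o => x + u *: a + t *: b)
      (fun u => u *: a).
    have := @is_diffD _ _ _ _ _ _ _ (s : R^o) (is_diffD (is_diff_cst x _)
      (is_diff_scalel s a)) (is_diff_cst (t *: b) s).
    move=> H; apply: is_diff_eq H _; apply/funext => u.
    by rewrite /= /GRing.add /= /GRing.zero /= add0r addr0.
  have dc := differentiable_comp (@ex_diff _ _ _ _ _ _ _ dl) df.
  apply: DeriveDef; first exact: diff_derivable.
  rewrite deriveE // (diff_comp (@ex_diff _ _ _ _ _ _ _ dl) df) /=.
  by rewrite diff_val scale1r.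
have dg s : s \in `]0, h[%R -> is_derive (s : R^o) (1 : R^o) g
    (F (x + s *: a + h *: b) - F (x + s *: a + 0 *: b)).
  rewrite in_itv /= => /andP[s0 sh].
  have sh' : 0 <= s <= h by apply/andP; split; lra.
  exact: is_deriveB (dline _ _ sh' hhh) (dline _ _ sh' h00).
have gc : {within `[0, h], continuous g}.
  apply: continuous_in_subspaceT => s; rewrite inE /= in_itv /= => sh.
  apply: differentiable_continuous; apply/derivable1_diffP.
  by have [] := is_deriveB (dline _ _ sh hhh) (dline _ _ sh h00).
have [c + gE] := MVT h0 dg gc.
rewrite in_itv /= => /andP[c0 ch].
have sc : 0 <= c <= h by apply/andP; split; lra.
have -> : f (x + h *: a + h *: b) - f (x + h *: a) - f (x + h *: b) + f x
    = g h - g 0.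
  by rewrite /g !scale0r !addr0 opprB addrA addrAC.
have [_ E1] := hr _ (lt_r _ _ sc hhh).
have [_ E2] := hr _ (lt_r _ _ sc h00).
have -> : g h - g 0 - h ^+ 2 * 'd F x b =
  h * ((F (x + c *: a + h *: b) - F x - 'd F x (x + c *: a + h *: b - x))
    - (F (x + c *: a + 0 *: b) - F x - 'd F x (x + c *: a + 0 *: b - x))).
  rewrite gE subr0.
  rewrite (_ : x + c *: a + h *: b - x = c *: a + h *: b); last first.
    by rewrite addrAC [x + _]addrC addrK.
  rewrite (_ : x + c *: a + 0 *: b - x = c *: a); last first.
    by rewrite scale0r addr0 [x + _]addrC addrK.
  rewrite linearD (_ : 'd F x (h *: b) = h * 'd F x b); first by ring.
  by rewrite linearZ.
rewrite normrM gtr0_norm // expr2 mulrCA ler_pM2l //.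
apply: le_trans (ler_normB _ _) _; apply: le_trans (lerD E1 E2) _.
rewrite -mulrDr -mulrA ler_pM2l // ler_pdivrMl //.
apply: le_trans (lerD (bnd _ _ sc hhh) (bnd _ _ sc h00)) _.
by rewrite -mulrDr mulrC ler_pM2r // /M ler_wpDr.
Qed.

Lemma schwarz_scalar V (f : V -> R^o) x a b : smooth_near f x ->
  'd (fun y => 'd f y a : R^o) x b = 'd (fun y => 'd f y b : R^o) x a.
Proof.
move=> sf; apply/eqP; rewrite -subr_eq0 -normr_eq0; apply/eqP/le_anti.
rewrite normr_ge0 andbT; apply/ler_addgt0Pl => e e0; rewrite addr0.
have e2 : 0 < e / 2 by rewrite divr_gt0.
have [d1 d10 h1] := second_difference a b sf e2.
have [d2 d20 h2] := second_difference b a sf e2.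
pose h : R := Num.min d1 d2 / 2.
have h0 : 0 < h by rewrite divr_gt0 // lt_min d10 d20.
have hm : h < Num.min d1 d2.
  by rewrite /h ltr_pdivrMr // mulr_natr mulr2n ltrDl lt_min d10 d20.
move: hm; rewrite lt_min => /andP[hd1 hd2].
have {}h1 := h1 h (introT andP (conj h0 hd1)).
have {}h2 := h2 h (introT andP (conj h0 hd2)).
set p := 'd _ x b in h1 *; set q := 'd _ x a in h2 *.
have hh : 0 < h ^+ 2 by rewrite exprn_gt0.
rewrite -(ler_pM2l hh) -[X in X * `|_|](gtr0_norm hh) -normrM.
set D1 := _ - _ * _ in h1; set D2 := _ - _ * _ in h2.
have -> : h ^+ 2 * (p - q) = D2 - D1.
  by rewrite /D1 /D2 (addrAC x (h *: b)); ring.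
apply: le_trans (ler_normB _ _) _; apply: le_trans (lerD h2 h1) _.
by rewrite -mulrDl -splitr mulrC.
Qed.

(** Coordinatewise, both sides are estimated by one second difference, which
    is symmetric in [a] and [b]. *)
Lemma schwarz V W (f : V -> W) x a b : fin_basis W -> smooth_near f x ->
  'd (fun y => 'd f y a : W) x b = 'd (fun y => 'd f y b : W) x a.
Proof.
move=> B sf.
have key (i : 'I_(fb_dim B)) : fb_coord i ('d (fun y => 'd f y a : W) x b) =
             fb_coord i ('d (fun y => 'd f y b : W) x a).
  have Lc : continuous (fb_coord i) by exact: fb_cont.
  have sfi : smooth_near (fb_coord i \o f) x.
    by apply: smooth_near_comp => //; exact: smooth_near_lin.
  have E u v : 'd (fun y => 'd (fb_coord i \o f) y u : R^o) x v
      = fb_coord i ('d (fun y => 'd f y u : W) x v).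
    have du := smooth_near_differentiable (smooth_near_d u sf).
    have [_ /(congr1 (@^~ v)) /= <-] := is_diff_lin_comp Lc du.
    apply: (congr1 (@^~ v)); apply: near_eq_diff.
      apply: filterS (smooth_near_diff sf) => y dy /=.
      by have [_ ->] := is_diff_lin_comp Lc dy.
    by have [] := is_diff_lin_comp Lc du.
  by rewrite -!E; exact: schwarz_scalar.
rewrite [LHS](fb_sum B) [RHS](fb_sum B).
by apply: eq_bigr => i _; rewrite key.
Qed.

End SmoothNear.

(** * Smooth maps into manifolds and tangent maps *)

Section SmoothAt.
Context {R : realType}.
Implicit Types (V W : normedModType R) (M N P : manifoldType R).

Lemma chart_at_atlas M (p : M) : atlas M (chart_at p).
Proof. by rewrite /chart_at; case: cid2. Qed.

Lemma chart_at_dom M (p : M) : dom (chart_at p) p.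
Proof. by rewrite /chart_at; case: cid2. Qed.

Lemma chart_at_cod M (p : M) : cod (chart_at p) (coord (chart_at p) p).
Proof. exact/coord_cod/chart_at_dom. Qed.

Lemma param_coord M n (c : chart R M n) p : dom c p -> param c (coord c p) = p.
Proof. by move=> cp; apply: coordK; apply/mem_set. Qed.

Lemma coord_param M n (c : chart R M n) u : cod c u -> coord c (param c u) = u.
Proof. by move=> cu; apply: paramK; apply/mem_set. Qed.

Lemma param_chart_at M (p : M) : param (chart_at p) (coord (chart_at p) p) = p.
Proof. exact/param_coord/chart_at_dom. Qed.

Lemma near_dom M n (c : chart R M n) p : dom c p -> \forall q \near p, dom c q.
Proof. by move=> cp; apply: (open_nbhs_nbhs (conj (dom_open c) cp)). Qed.

Lemma near_cod M n (c : chart R M n) u : cod c u -> \forall v \near u, cod c v.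
Proof. by move=> cu; apply: (open_near (@cod_open _ _ _ c) cu). Qed.

Definition smooth_at V M (F : V -> M) (u : V) :=
  {for u, continuous F} /\
  forall d, atlas M d -> dom d (F u) -> smooth_near (coord d \o F) u.

Lemma smooth_at_dom V M n (F : V -> M) u (d : chart R M n) :
  smooth_at F u -> dom d (F u) ->
  \forall v \near u, dom d (F v).
Proof. by move=> [cF _] dF; exact: (cF _ (near_dom dF)). Qed.

Lemma smooth_into_at V N (U : set V) (f : V -> N) u :
  open U -> smooth_into U f -> U u -> smooth_at f u.
Proof.
move=> oU [fc fs] Uu; split; first exact/fc/mem_set.
move=> d ad du; exists (U `&` f @^-1` dom d); last exact: fs.
split=> //; rewrite openE => v [Uv dv].
apply: filterI; first exact: (open_nbhs_nbhs (conj oU Uv)).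
exact: (fc v (mem_set Uv) _ (near_dom dv)).
Qed.

Lemma smooth_at_ext V M (F G : V -> M) u :
  {near u, F =1 G} -> smooth_at F u -> smooth_at G u.
Proof.
move=> FG [cF sF]; have E : F u = G u := nbhs_singleton FG; split.
  exact: near_eq_continuous FG cF.
move=> d ad du; apply: smooth_near_ext (sF d ad _); last by rewrite E.
by apply: filterS FG => v /= ->.
Qed.

Lemma smooth_at_comp V M n (F : 'rV[R]_n -> M) (g : V -> 'rV[R]_n) v :
  smooth_near g v -> smooth_at F (g v) -> smooth_at (F \o g) v.
Proof.
move=> sg [cF sF]; split.
  by apply: continuous_comp => //; exact: smooth_near_continuous.
by move=> d ad du; apply: smooth_near_comp (rV_fin_basis n) sg (sF _ ad du).
Qed.

Lemma smooth_at_cst V M (p : M) (v : V) : smooth_at (fun=> p) v.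
Proof.
by split=> [|d _ _]; [exact: cvg_cst|exact: smooth_near_cst].
Qed.

Lemma smooth_at_param M c u : atlas M c -> cod c u -> smooth_at (param c) u.
Proof.
move=> ac cu; split; first exact/param_continuous/mem_set.
move=> d ad du; exists (cod c `&` param c @^-1` dom d); last first.
  exact: atlas_smooth.
split=> //; rewrite openE => v [cv dv].
apply: filterI; first exact: near_cod.
exact: (param_continuous (mem_set cv) (near_dom dv)).
Qed.

Lemma smooth_at_param_fst (M : manifoldType R) c u W (w : W) :
  atlas M c -> cod c u ->
  smooth_at (fun z : 'rV[R]_(mdim M) * W => param c z.1) (u, w).
Proof.
move=> ac cu; apply: (smooth_at_comp (g := fst)); first exact: smooth_near_fst.
exact: smooth_at_param.
Qed.

Lemma smooth_at_param_snd (M : manifoldType R) c u W (w : W) :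
  atlas M c -> cod c u ->
  smooth_at (fun z : W * 'rV[R]_(mdim M) => param c z.2) (w, u).
Proof.
move=> ac cu; apply: (smooth_at_comp (g := snd)); first exact: smooth_near_snd.
exact: smooth_at_param.
Qed.

Lemma smooth_at_factor V M n (F : V -> M) u (c : chart R M n) :
  smooth_at F u -> dom c (F u) ->
  \forall v \near u, param c (coord c (F v)) = F v.
Proof.
move=> sF dF; apply: filterS (smooth_at_dom sF dF) => v; exact: param_coord.
Qed.

(** Smoothness between manifolds, tested on maps from normed modules: closure
    under composition, for one or several variables, becomes immediate and no
    atlas has to be put on products. *)
Definition preserves_smooth M N (f : M -> N) :=
  forall V (F : V -> M) u, smooth_at F u -> smooth_at (f \o F) u.

Definition preserves_smooth2 M N P (f : M -> N -> P) :=
  forall V (F : V -> M) (G : V -> N) u, smooth_at F u -> smooth_at G u ->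
  smooth_at (fun v => f (F v) (G v)) u.

Lemma preserves_smooth2_r (M N P : manifoldType R) (f : M -> N -> P) p :
  preserves_smooth2 f -> preserves_smooth (f p).
Proof. by move=> sf V F u sF; apply: sf sF; exact: smooth_at_cst. Qed.

Lemma smooth_preserves M N (f : M -> N) : smooth f -> preserves_smooth f.
Proof.
move=> sf V F u sF.
have ac := chart_at_atlas (F u); have dc := chart_at_dom (F u).
have sf' : smooth_at (f \o param (chart_at (F u))) (coord (chart_at (F u)) (F u)).
  exact: (smooth_into_at (@cod_open _ _ _ _) (sf _ ac) (coord_cod dc)).
have [_ /(_ _ ac dc) sc] := sF.
apply: smooth_at_ext (smooth_at_comp sc sf').
by apply: filterS (smooth_at_factor sF dc) => v /= ->.
Qed.

Lemma smooth2_preserves M N P (f : M -> N -> P) :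
  smooth2 f -> preserves_smooth2 f.
Proof.
move=> sf V F G u sF sG.
have ac := chart_at_atlas (F u); have dc := chart_at_dom (F u).
have ad := chart_at_atlas (G u); have dd := chart_at_dom (G u).
have oU : open (cod (chart_at (F u)) `*` cod (chart_at (G u))).
  by apply: open_setX; exact: (@cod_open _ _ _ _).
have [cf' sf'] := smooth_into_at oU (sf _ _ ac ad)
  (conj (coord_cod dc) (coord_cod dd) : (_ `*` _) (_, _)).
have [_ /(_ _ ac dc) scF] := sF; have [_ /(_ _ ad dd) scG] := sG.
have sp := smooth_near_pair scF scG.
have E : {near u, (fun v => f (param (chart_at (F u)) (coord (chart_at (F u)) (F v)))
     (param (chart_at (G u)) (coord (chart_at (G u)) (G v)))) =1
     fun v => f (F v) (G v)}.
  by apply: filterS2 (smooth_at_factor sF dc) (smooth_at_factor sG dd) => v -> ->.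
apply: smooth_at_ext E _; split.
  exact: (continuous_comp (smooth_near_continuous sp) cf').
move=> d a_d du.
exact: (smooth_near_comp (prod_fin_basis (rV_fin_basis _) (rV_fin_basis _)) sp
  (sf' d a_d du)).
Qed.

Lemma preserves_smooth_continuous (M N : manifoldType R) (f : M -> N) :
  preserves_smooth f -> continuous f.
Proof.
move=> sf p; have dc := chart_at_dom p.
have [cf _] := sf _ _ _ (smooth_at_param (chart_at_atlas p) (coord_cod dc)).
have cc : {for p, continuous (coord (chart_at p))}.
  exact: coord_continuous (mem_set dc).
have cfc := continuous_comp cc cf.
apply: near_eq_continuous cfc.
by apply: filterS (near_dom dc) => q /param_coord /= ->.
Qed.

(** Near [F u] a chart and its inverse cancel, so the chain rule of normed
    modules applies, in any chart at that point. *)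
Lemma diff_smooth_at V W M (F : V -> M) (g : M -> W) u c v :
  smooth_at F u -> atlas M c -> dom c (F u) ->
  differentiable (g \o param c) (coord c (F u)) ->
  'd (g \o F) u v = 'd (g \o param c) (coord c (F u)) ('d (coord c \o F) u v).
Proof.
move=> sF ac dF dg; have [_ /(_ _ ac dF)/smooth_near_differentiable dcF] := sF.
rewrite -(diff_compE v dcF dg); apply: (congr1 (@^~ v)).
apply: near_eq_diff; last exact: differentiable_comp dcF dg.
by apply: filterS (smooth_at_factor sF dF) => w /= ->.
Qed.

Lemma smooth_at_chart M N (f : M -> N) p c d : preserves_smooth f ->
  atlas M c -> dom c p -> atlas N d -> dom d (f p) ->
  smooth_near (coord d \o f \o param c) (coord c p).
Proof.
move=> sf ac dp ad dfp.
have [_] := sf _ _ _ (smooth_at_param ac (coord_cod dp)).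
by apply=> //=; rewrite param_coord.
Qed.

(** Tangent maps are computed in the chart at [f p], which only depends on the
    value of [f p]: this replaces transport along [f p = q]. *)
Lemma tmap_chart M N (f : M -> N) p q v : f p = q ->
  tmap f p v = 'd (coord (chart_at q) \o f \o param (chart_at p))
     (coord (chart_at p) p) v :> 'rV[R]_(mdim N).
Proof. by move=> <-. Qed.

Lemma tmap_comp M N P (f : M -> N) (g : N -> P) p q v : f p = q ->
  preserves_smooth f -> preserves_smooth g ->
  tmap (g \o f) p v = tmap g q (tmap f p v : 'rV[R]_(mdim N))
     :> 'rV[R]_(mdim P).
Proof.
move=> <- {q} sf sg; have ac := chart_at_atlas p; have dc := chart_at_dom p.
have sF := sf _ _ _ (smooth_at_param ac (coord_cod dc)).
have E : (f \o param (chart_at p)) (coord (chart_at p) p) = f p.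
  by rewrite /= param_coord.
have key := @diff_smooth_at _ _ _ _ (coord (chart_at (g (f p))) \o g)
  _ (chart_at (f p)) v sF (chart_at_atlas _).
rewrite E in key; apply: key; first exact: chart_at_dom.
apply: smooth_near_differentiable.
by apply: smooth_at_chart => //; by [exact: chart_at_atlas|exact: chart_at_dom].
Qed.

Lemma tmap_id M (p : M) v : tmap id p v = v :> 'rV[R]_(mdim M).
Proof.
apply: diff_near_id.
by apply: filterS (near_cod (chart_at_cod p)) => u /= /coord_param ->.
Qed.

Lemma tmap_linear M N (f : M -> N) p : linear (tmap f p).
Proof. by move=> a u v; rewrite /tmap linearP. Qed.

End SmoothAt.

(** * The bracket of a Lie group in the chart at the unit *)

Section UnitChart.
Context {R : realType} (G : lieGroupType R).

Definition unit_chart := chart_at (1%g : G).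

Definition unit_coord := coord unit_chart (1%g : G).

Definition chart_mul (z : 'rV[R]_(mdim G) * 'rV[R]_(mdim G)) :=
  coord unit_chart (param unit_chart z.1 * param unit_chart z.2)%g.

Lemma unit_chart_atlas : atlas G unit_chart. Proof. exact: chart_at_atlas. Qed.

Lemma unit_coord_cod : cod unit_chart unit_coord.
Proof. exact: chart_at_cod. Qed.

Lemma unit_chart1 : dom unit_chart 1%g. Proof. exact: chart_at_dom. Qed.

Lemma param_unit_coord : param unit_chart unit_coord = 1%g.
Proof. exact: param_chart_at. Qed.

Lemma mulg_preserves : preserves_smooth2 (fun x y : G => x * y)%g.
Proof. exact: (smooth2_preserves mulg_smooth). Qed.

Lemma invg_preserves : preserves_smooth (fun x : G => x^-1)%g.
Proof. exact: (smooth_preserves invg_smooth). Qed.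

Lemma smooth_at_chart_mul :
  smooth_at (fun z => param unit_chart z.1 * param unit_chart z.2)%g
  (unit_coord, unit_coord).
Proof.
apply: mulg_preserves.
  exact: smooth_at_param_fst unit_chart_atlas unit_coord_cod.
exact: smooth_at_param_snd unit_chart_atlas unit_coord_cod.
Qed.

Lemma chart_mul_smooth : smooth_near chart_mul (unit_coord, unit_coord).
Proof.
have [_] := smooth_at_chart_mul; apply; first exact: unit_chart_atlas.
by rewrite /= param_unit_coord mulg1; exact: unit_chart1.
Qed.

Lemma param_chart_mul : \forall z \near (unit_coord, unit_coord),
  param unit_chart (chart_mul z) = (param unit_chart z.1 * param unit_chart z.2)%g.
Proof.
apply: smooth_at_factor smooth_at_chart_mul _.
by rewrite /= param_unit_coord mulg1; exact: unit_chart1.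
Qed.

Lemma chart_mulx1 u : cod unit_chart u -> chart_mul (u, unit_coord) = u.
Proof. by move=> cu; rewrite /chart_mul /= param_unit_coord mulg1 coord_param. Qed.

Lemma chart_mul1x u : cod unit_chart u -> chart_mul (unit_coord, u) = u.
Proof. by move=> cu; rewrite /chart_mul /= param_unit_coord mul1g coord_param. Qed.

Lemma diff_chart_mull a : 'd chart_mul (unit_coord, unit_coord) (a, 0) = a.
Proof.
have dM := smooth_near_differentiable chart_mul_smooth.
rewrite -(diff_partial_l a dM); apply: diff_near_id.
by apply: filterS (near_cod unit_coord_cod) => u /chart_mulx1 ->.
Qed.

Lemma diff_chart_mulr a : 'd chart_mul (unit_coord, unit_coord) (0, a) = a.
Proof.
have dM := smooth_near_differentiable chart_mul_smooth.
rewrite -(diff_partial_r a dM); apply: diff_near_id.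
by apply: filterS (near_cod unit_coord_cod) => u /chart_mul1x ->.
Qed.

(** The left invariant field with value [b] at the unit, read in the chart. *)
Definition left_field (b u : 'rV[R]_(mdim G)) : 'rV[R]_(mdim G) :=
  'd chart_mul (u, unit_coord) (0, b).

Lemma diff_left_field b a : differentiable (left_field b) unit_coord /\
  'd (left_field b) unit_coord a =
  'd (fun z => 'd chart_mul z (0, b) : 'rV[R]_(mdim G))
    (unit_coord, unit_coord) (a, 0).
Proof.
have d1 := smooth_near_differentiable (smooth_near_d (0, b) chart_mul_smooth).
have dp := is_diff_pairl unit_coord unit_coord.
have d2 := @ex_diff _ _ _ _ _ _ _ dp.
split; first exact: (differentiable_comp d2 d1).
rewrite /left_field (diff_compE _ d2 d1).
have [_ ->] := dp.
by [].
Qed.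

(** The transition map from the chart at [param unit_chart u] to the chart at
    the unit cancels the chart in which [left_invariant] is expressed there,
    and only the multiplication in the chart at the unit remains. *)
Lemma field_left_invariant b : \forall u \near unit_coord,
  field_in_chart unit_chart (@left_invariant R G b) u = left_field b u.
Proof.
near=> u; have cu : cod unit_chart u by near: u; exact: (near_cod unit_coord_cod).
have dM : differentiable chart_mul (u, unit_coord).
  by near: u; exact: (near_prod_l (smooth_near_diff chart_mul_smooth)).
rewrite /field_in_chart; set p := param unit_chart u.
have sF : smooth_at (fun w => (p * param unit_chart w)%g) unit_coord.
  apply: mulg_preserves; first exact: smooth_at_cst.
  exact: smooth_at_param unit_chart_atlas unit_coord_cod.
have E : (p * param unit_chart unit_coord)%g = p by rewrite param_unit_coord mulg1.
rewrite /left_invariant (tmap_chart (q := p)) ?mulg1 //.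
rewrite /left_field -(diff_partial_r b dM).
have key := @diff_smooth_at _ _ _ _ _ (coord unit_chart) _ (chart_at p) b sF
  (chart_at_atlas _).
rewrite E in key.
have dtr : differentiable (coord unit_chart \o param (chart_at p))
    (coord (chart_at p) p).
  apply: smooth_near_differentiable.
  apply: (@smooth_at_chart _ _ _ id p (chart_at p) unit_chart) => //.
  - exact: chart_at_atlas.
  - exact: chart_at_dom.
  - exact: unit_chart_atlas.
  - exact: param_dom.
exact: esym (key (chart_at_dom p) dtr).
Unshelve. all: by end_near. Qed.

Lemma lie_bracketE (a b : tangent (1%g : G)) : lie_bracket a b =
  'd (left_field b) unit_coord a - 'd (left_field a) unit_coord b
    :> 'rV[R]_(mdim G).
Proof.
have W d : field_in_chart unit_chart (@left_invariant R G d) unit_coord = d.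
  rewrite (nbhs_singleton (field_left_invariant d)); exact: diff_chart_mulr.
have E d x : 'd (field_in_chart unit_chart (@left_invariant R G d)) unit_coord x =
    'd (left_field d) unit_coord x.
  apply: (congr1 (@^~ x)); apply: near_eq_diff.
    by apply: filterS (field_left_invariant d) => u ->.
  by have [] := diff_left_field d 0.
have Wa : 'd (field_in_chart unit_chart (@left_invariant R G b)) unit_coord a =
    'd (field_in_chart unit_chart (@left_invariant R G b)) unit_coord
       (field_in_chart unit_chart (@left_invariant R G a) unit_coord).
  exact: congr1 (esym (W a)).
have Wb : 'd (field_in_chart unit_chart (@left_invariant R G a)) unit_coord b =
    'd (field_in_chart unit_chart (@left_invariant R G a)) unit_coord
       (field_in_chart unit_chart (@left_invariant R G b) unit_coord).
  exact: congr1 (esym (W b)).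
apply: etrans (congr2 (fun x y => x - y) (E b a) (E a b)).
exact: esym (congr2 (fun x y => x - y) Wa Wb).
Qed.

End UnitChart.

Arguments chart_mul {R G} z.
Arguments left_field {R G} b u.

(** * Differentials of smooth representations *)

Section Representation.
Context {R : realType}.
Variables (G : lieGroupType R) (n : nat).

(** The differential of [rho] at the unit only depends on the germs there of
    the orbit maps, so smoothness is asked for these, one vector at a time. *)
Record smooth_rep (rho : G -> 'rV[R]_n -> 'rV[R]_n) : Prop := SmoothRep {
  rep_linear : forall g, linear (rho g);
  rep_mul : forall g h v, rho (g * h)%g v = rho g (rho h v);
  rep_smooth : forall v,
    smooth_near (fun u => rho (param (unit_chart G) u) v) (unit_coord G)
}.

Definition rep_diff (rho : G -> 'rV[R]_n -> 'rV[R]_n)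
    (a : 'rV[R]_(mdim G)) (v : 'rV[R]_n) : 'rV[R]_n :=
  'd (fun u => rho (param (unit_chart G) u) v) (unit_coord G) a.

Variable rho : G -> 'rV[R]_n -> 'rV[R]_n.
Hypothesis rhoP : smooth_rep rho.

Local Notation f := (fun v u => rho (param (unit_chart G) u) v).

Lemma rep_differentiable v : differentiable (f v) (unit_coord G).
Proof. exact/smooth_near_differentiable/rep_smooth. Qed.

Lemma rep_diff_bilinear : bilinear_map (rep_diff rho).
Proof.
split=> [a r v w|v r a b]; last exact: linearP.
have E : f (r *: v + w) = fun u => r *: f v u + f w u.
  by apply/funext => u; rewrite rep_linear.
have dv := rep_differentiable v; have dw := rep_differentiable w.
rewrite {1}/rep_diff E.
apply: etrans (diff_addE a (differentiableZ r dv) dw) _.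
have Z : 'd (fun u => r *: f v u) (unit_coord G) a = r *: 'd (f v) (unit_coord G) a.
  exact: (congr1 (fun h => h a) (diffZ r dv)).
exact: (congr2 (fun x y : 'rV[R]_n => x + y) Z erefl).
Qed.

(** This is [rho (x * y) v = rho x (rho y v)] differentiated in [y] at the
    unit. *)
Lemma rep_diff_left_field b v :
  {near unit_coord G, (fun x => 'd (f v) x (left_field b x) : 'rV[R]_n) =1
     f (rep_diff rho b v)}.
Proof.
near=> x.
have A : {near unit_coord G, (fun y => f v (chart_mul (x, y))) =1
    fun y => rho (param (unit_chart G) x) (f v y)}.
  have : \forall y \near unit_coord G, param (unit_chart G) (chart_mul (x, y)) =
      (param (unit_chart G) x * param (unit_chart G) y)%g.
    by near: x; exact: (near_prod (param_chart_mul G)).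
  by apply: filterS => y ->; rewrite rep_mul.
have cx : cod (unit_chart G) x by near: x; exact: (near_cod (unit_coord_cod G)).
have dM : differentiable chart_mul (x, unit_coord G).
  by near: x; exact: (near_prod_l (smooth_near_diff (chart_mul_smooth G))).
have dp := is_diff_pairr x (unit_coord G).
have dMx : differentiable (fun y => chart_mul (x, y)) (unit_coord G).
  exact: (differentiable_comp (@ex_diff _ _ _ _ _ _ _ dp) dM).
have dfx : differentiable (f v) (chart_mul (x, unit_coord G)).
  rewrite chart_mulx1 //; near: x; exact: smooth_near_diff (rep_smooth rhoP v).
have dL := is_diff_linear_comp (rep_linear rhoP (param (unit_chart G) x))
  (rV_fin_basis n) (rep_differentiable v).
have E1 : 'd (fun y => f v (chart_mul (x, y))) (unit_coord G) b =
    'd (f v) x (left_field b x).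
  apply: etrans (diff_compE b dMx dfx) _.
  by rewrite chart_mulx1 //; congr ('d _ _ _); exact: diff_partial_r.
apply: etrans (esym E1) _.
apply: etrans (congr1 (@^~ b) (near_eq_diff _ (@ex_diff _ _ _ _ _ _ _ dL))) _.
  by apply: filterS A => y ->.
exact: (congr1 (@^~ b) (@diff_val _ _ _ _ _ _ _ dL)).
Unshelve. all: by end_near. Qed.

(** Differentiating [rep_diff_left_field] once more, now in [x], produces the
    second derivative of [rho] and the derivative of the left invariant
    field. *)
Lemma rep_diff_rep_diff a b v : rep_diff rho a (rep_diff rho b v) =
  'd (fun y => 'd (f v) y b : 'rV[R]_n) (unit_coord G) a
  + 'd (f v) (unit_coord G) ('d (left_field b) (unit_coord G) a).
Proof.
have [dl _] := diff_left_field b a.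
have [dk E] := diff_apply (h := id) (w := left_field b) a (rV_fin_basis _)
  (rep_smooth rhoP v) (@ex_diff _ _ _ _ _ _ _ (is_diff_id _)) dl.
have I : 'd id (unit_coord G) a = a by apply: diff_near_id; exact: filterE.
have J : left_field b (unit_coord G) = b by exact: diff_chart_mulr.
have X t : t = a ->
    'd (fun y => 'd (f v) y (left_field b (unit_coord G)) : 'rV[R]_n)
      (unit_coord G) t =
    'd (fun y => 'd (f v) y b : 'rV[R]_n) (unit_coord G) a by move=> ->; rewrite J.
apply: etrans (etrans E (congr2 (fun x y : 'rV[R]_n => x + y) (X _ I) erefl)).
apply: (congr1 (@^~ a)); apply: near_eq_diff dk.
exact: rep_diff_left_field.
Qed.

(** The second derivatives cancel by symmetry and leave the bracket. *)
Lemma rep_diff_module (a b : tangent (1%g : G)) v :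
  rep_diff rho (lie_bracket a b) v =
  rep_diff rho a (rep_diff rho b v) - rep_diff rho b (rep_diff rho a v).
Proof.
have S := schwarz a b (rV_fin_basis n) (rep_smooth rhoP v).
have LB x y : 'd (f v) (unit_coord G) (x - y) =
  'd (f v) (unit_coord G) x - 'd (f v) (unit_coord G) y := linearB _ x y.
have alg (p q x y : 'rV[R]_n) : p = q -> x - y = (q + x) - (p + y).
  by move=> ->; rewrite opprD addrACA subrr add0r.
rewrite !rep_diff_rep_diff; apply: etrans (alg _ _ _ _ S).
exact: etrans (congr1 ('d (f v) (unit_coord G)) (lie_bracketE a b)) (LB _ _).
Qed.

End Representation.

(** * The isotropy representation at a fixed point *)

Section Isotropy.
Context {R : realType}.
Variables (G : lieGroupType R) (X : manifoldType R) (act : G -> X -> X) (e : X).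
Hypothesis actM : forall g h x, act (g * h)%g x = act g (act h x).
Hypothesis act_e : forall g, act g e = e.
Hypothesis act_smooth : preserves_smooth2 act.

Definition isotropy (g : G) (v : 'rV[R]_(mdim X)) : 'rV[R]_(mdim X) :=
  tmap (act g) e v.

Local Notation ce := (chart_at e).
Local Notation we := (coord (chart_at e) e).

Definition chart_act (z : 'rV[R]_(mdim G) * 'rV[R]_(mdim X)) :=
  coord (chart_at e) (act (param (unit_chart G) z.1) (param (chart_at e) z.2)).

Lemma smooth_at_chart_act : smooth_at (fun z =>
  act (param (unit_chart G) z.1) (param (chart_at e) z.2)) (unit_coord G, we).
Proof.
apply: act_smooth.
  exact: smooth_at_param_fst (unit_chart_atlas G) (unit_coord_cod G).
exact: smooth_at_param_snd (chart_at_atlas e) (chart_at_cod e).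
Qed.

Lemma chart_act_smooth : smooth_near chart_act (unit_coord G, we).
Proof.
have [_] := smooth_at_chart_act; apply; first exact: chart_at_atlas.
by rewrite /= param_chart_at act_e; exact: chart_at_dom.
Qed.

Lemma param_chart_act : \forall z \near (unit_coord G, we), param ce (chart_act z) =
  act (param (unit_chart G) z.1) (param ce z.2).
Proof.
apply: smooth_at_factor smooth_at_chart_act _.
by rewrite /= param_chart_at act_e; exact: chart_at_dom.
Qed.

Lemma isotropyE v : \forall u \near unit_coord G,
  isotropy (param (unit_chart G) u) v = 'd chart_act (u, we) (0, v).
Proof.
have := near_prod_l (smooth_near_diff chart_act_smooth).
apply: filterS => u dA; rewrite /isotropy (tmap_chart (q := e)) //.
exact: (diff_partial_r v dA).
Qed.

Lemma isotropy_rep : smooth_rep isotropy.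
Proof.
split=> [g|g h v|v].
- exact: tmap_linear.
- rewrite /isotropy; have -> : act (g * h)%g = act g \o act h.
    by apply/funext => x; rewrite actM.
  by apply: tmap_comp => //; exact: preserves_smooth2_r.
have dA := smooth_near_d (0, v) chart_act_smooth.
have sp : smooth_near (fun u => (u, we)) (unit_coord G).
  by apply: smooth_near_pair; [exact: smooth_near_id|exact: smooth_near_cst].
have := smooth_near_comp (prod_fin_basis (rV_fin_basis _) (rV_fin_basis _)) sp dA.
apply: smooth_near_ext.
by apply: filterS (isotropyE v) => u /= ->.
Qed.

End Isotropy.

(** * The adjoint representation and the Lie algebra *)

Section Adjoint.
Context {R : realType} (G : lieGroupType R).

Definition gconj (g h : G) : G := (g * h * g^-1)%g.

Lemma gconjM g h x : gconj (g * h)%g x = gconj g (gconj h x).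
Proof. by rewrite /gconj invgM !mulgA. Qed.

Lemma gconj1 g : gconj g 1%g = 1%g.
Proof. by rewrite /gconj mulg1 mulgV. Qed.

Lemma gconj_smooth : preserves_smooth2 gconj.
Proof.
move=> V F H u sF sH; apply: (@mulg_preserves R G); last exact: invg_preserves.
exact: mulg_preserves.
Qed.

Definition Ad := isotropy gconj 1%g.

Lemma Ad_rep : smooth_rep Ad.
Proof. exact: isotropy_rep gconjM gconj1 gconj_smooth. Qed.

Lemma Ad1 b : Ad 1%g b = b.
Proof.
rewrite /Ad /isotropy; have -> : gconj 1%g = id.
  by apply/funext => x; rewrite /gconj mul1g invg1 mulg1.
exact: tmap_id.
Qed.

(** This is [(g * h * g^-1) * g = g * h] differentiated in [h] at the unit. *)
Lemma Ad_left_field b : {near unit_coord G, (fun u =>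
   'd chart_mul (unit_coord G, u) (Ad (param (unit_chart G) u) b, 0))
     =1 left_field b}.
Proof.
pose k := chart_act gconj (1%g : G).
have sk : smooth_near k (unit_coord G, unit_coord G).
  exact: chart_act_smooth gconj1 gconj_smooth.
near=> u.
have A : {near unit_coord G, (fun w => chart_mul (k (u, w), u)) =1
    (fun w => chart_mul (u, w))}.
  have : \forall w \near unit_coord G, param (unit_chart G) (k (u, w)) =
      gconj (param (unit_chart G) u) (param (unit_chart G) w).
    by near: u; exact: (near_prod (param_chart_act gconj1 gconj_smooth)).
  by apply: filterS => w E; rewrite /chart_mul /= E /gconj mulgVK.
have cu : cod (unit_chart G) u by near: u; exact: (near_cod (unit_coord_cod G)).
have dk : differentiable k (u, unit_coord G).
  by near: u; exact: (near_prod_l (smooth_near_diff sk)).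
have dM : differentiable chart_mul (u, unit_coord G).
  by near: u; exact: (near_prod_l (smooth_near_diff (chart_mul_smooth G))).
have dM' : differentiable chart_mul (unit_coord G, u).
  by near: u; exact: (near_prod_r (smooth_near_diff (chart_mul_smooth G))).
have ko : k (u, unit_coord G) = unit_coord G.
  by rewrite /k /chart_act /= param_unit_coord gconj1.
have dpr := @ex_diff _ _ _ _ _ _ _ (is_diff_pairr u (unit_coord G)).
have dku : differentiable (fun w => k (u, w)) (unit_coord G).
  exact: (differentiable_comp dpr dk).
have dp := differentiable_pair dku (differentiable_cst u (unit_coord G)).
have dgm : differentiable chart_mul (k (u, unit_coord G), u) by rewrite ko.
have AdE : 'd (fun w => k (u, w)) (unit_coord G) b = Ad (param (unit_chart G) u) b.
  by rewrite /Ad /isotropy (tmap_chart (q := 1%g)) // gconj1.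
have E1 : 'd (fun w => (k (u, w), u)) (unit_coord G) b =
   (Ad (param (unit_chart G) u) b, 0).
  exact: etrans (diff_pair_cst u b dku) (congr1 (pair^~ _) AdE).
have E2 : 'd (fun w => chart_mul (k (u, w), u)) (unit_coord G) b =
   'd chart_mul (unit_coord G, u) (Ad (param (unit_chart G) u) b, 0).
  apply: etrans (diff_compE (f := fun w => (k (u, w), u)) b dp dgm) _.
  by rewrite E1 /= ko.
apply: etrans (esym E2) _.
have E3 : 'd (fun w => chart_mul (u, w)) (unit_coord G) b = left_field b u.
  exact: diff_partial_r b dM.
apply: etrans _ E3; apply: (congr1 (fun h => h b)); apply: near_eq_diff.
  by apply: filterS A => w ->.
exact: (differentiable_comp dpr dM).
Unshelve. all: by end_near. Qed.

(** Differentiating [Ad_left_field] in [g] compares [rep_diff Ad a b] with the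
    two mixed second derivatives of the multiplication, whose difference is
    the bracket. *)
Lemma rep_diff_Ad (a b : tangent (1%g : G)) : rep_diff Ad a b = lie_bracket a b.
Proof.
pose w u := (Ad (param (unit_chart G) u) b, 0) : 'rV[R]_(mdim G) * 'rV[R]_(mdim G).
have dAd := rep_differentiable Ad_rep b.
have dw : differentiable w (unit_coord G).
  exact: differentiable_pair dAd (differentiable_cst _ _).
have wE : 'd w (unit_coord G) a = (rep_diff Ad a b, 0).
  exact: (diff_pair_cst (0 : 'rV[R]_(mdim G)) a dAd).
have w0 : w (unit_coord G) = (b, 0) by rewrite /w param_unit_coord Ad1.
have [dpr hE] := is_diff_pairr (unit_coord G) (unit_coord G).
have [dk E] := diff_apply (h := fun u => (unit_coord G, u)) (w := w) a
  (prod_fin_basis (rV_fin_basis _) (rV_fin_basis _)) (chart_mul_smooth G) dpr dw.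
have E1 : 'd (left_field b) (unit_coord G) a =
    'd (fun y => 'd chart_mul y (b, 0) : 'rV[R]_(mdim G))
      (unit_coord G, unit_coord G) (0, a)
    + rep_diff Ad a b.
  apply: etrans (etrans _ E) _.
    by apply: (congr1 (fun h => h a)); apply: near_eq_diff dk; exact: Ad_left_field.
  rewrite w0; congr (_ + _).
    exact: (congr1 (fun t => 'd (fun y => 'd chart_mul y (b, 0) : 'rV[R]_(mdim G))
      (unit_coord G, unit_coord G) (t a)) hE).
  apply: etrans (congr1 ('d chart_mul (unit_coord G, unit_coord G)) wE) _.
  exact: diff_chart_mull.
have S := schwarz (b, 0) (0, a) (rV_fin_basis _) (chart_mul_smooth G).
have [_ E2] := diff_left_field a b.
apply: esym; apply: etrans (lie_bracketE a b) _.
apply: etrans (congr2 (fun x y : 'rV[R]_(mdim G) => x - y) E1 (etrans E2 (esym S))) _.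
by rewrite addrC addKr.
Qed.

(** Bilinearity and the Jacobi identity are properties of the adjoint
    representation, by [rep_diff_Ad]. *)
Lemma lie_bracket_lie_algebra : lie_algebra (@lie_bracket R G).
Proof.
have E : @lie_bracket R G = rep_diff Ad.
  by apply/funext => a; apply/funext => b; rewrite rep_diff_Ad.
have [linr linl] := rep_diff_bilinear Ad_rep.
have anti (a b : tangent (1%g : G)) : lie_bracket a b = - lie_bracket b a.
  by rewrite lie_bracketE [in RHS]lie_bracketE opprB.
have mod (a b c : tangent (1%g : G)) : lie_bracket (lie_bracket a b) c =
    lie_bracket a (lie_bracket b c) - lie_bracket b (lie_bracket a c).
  by rewrite -!(rep_diff_Ad, rep_diff_module Ad_rep).
split; first by rewrite E; split.
  by move=> a; rewrite lie_bracketE subrr.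
have N (x y : tangent (1%g : G)) : lie_bracket x (- y) = - lie_bracket x y.
  pose L : {linear _ -> _} :=
    HB.pack (rep_diff Ad x) (GRing.isLinear.Build _ _ _ _ _ (linr x)).
  by rewrite E; exact: (linearN L y).
move=> a b c; rewrite (anti c (lie_bracket a b)) (anti c a) mod N.
exact: subrr.
Qed.

End Adjoint.

(** * Intertwining maps *)

Section Intertwine.
Context {R : realType}.
Implicit Types G P : lieGroupType R.

Lemma diff_rep_pull P G n (rho : G -> 'rV[R]_n -> 'rV[R]_n) (phi : P -> G) a v :
  smooth_rep rho -> preserves_smooth phi -> phi 1%g = 1%g ->
  differentiable (fun u => rho (phi (param (unit_chart P) u)) v) (unit_coord P) /\
  'd (fun u => rho (phi (param (unit_chart P) u)) v) (unit_coord P) a =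
    rep_diff rho (tmap phi 1%g a) v.
Proof.
move=> rP sphi phi1.
have sF := sphi _ _ _ (smooth_at_param (unit_chart_atlas P) (unit_coord_cod P)).
have F1 : phi (param (unit_chart P) (unit_coord P)) = 1%g.
  by rewrite param_unit_coord.
have dF : dom (unit_chart G) (phi (param (unit_chart P) (unit_coord P))).
  by rewrite F1; exact: unit_chart1.
have [_ /(_ _ (unit_chart_atlas G) dF)/smooth_near_differentiable dc] := sF.
have c1 : coord (unit_chart G) (phi (param (unit_chart P) (unit_coord P))) =
    unit_coord G.
  by rewrite F1.
have df : differentiable (fun u => rho (param (unit_chart G) u) v)
    (coord (unit_chart G) (phi (param (unit_chart P) (unit_coord P)))).
  by rewrite c1; exact: rep_differentiable.
split.
  apply: near_eq_differentiable (differentiable_comp dc df).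
  by apply: filterS (smooth_at_factor sF dF) => u /= ->.
apply: etrans (diff_smooth_at (g := fun x => rho x v) a sF
  (unit_chart_atlas G) dF df) _.
by rewrite /= c1 /rep_diff (tmap_chart (q := 1%g)).
Qed.

(** The common group [P] allows at once for a morphism [P -> G2] (with [phi1]
    the identity) and for the restriction of both representations to a
    subgroup. *)
Lemma rep_diff_intertwine P G1 G2 n1 n2 (rho1 : G1 -> 'rV[R]_n1 -> 'rV[R]_n1)
    (rho2 : G2 -> 'rV[R]_n2 -> 'rV[R]_n2) (phi1 : P -> G1) (phi2 : P -> G2)
    (L : 'rV[R]_n1 -> 'rV[R]_n2) :
  smooth_rep rho1 -> smooth_rep rho2 ->
  preserves_smooth phi1 -> preserves_smooth phi2 ->
  phi1 1%g = 1%g -> phi2 1%g = 1%g -> linear L ->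
  (forall k v, L (rho1 (phi1 k) v) = rho2 (phi2 k) (L v)) ->
  forall a v, L (rep_diff rho1 (tmap phi1 1%g a) v) =
    rep_diff rho2 (tmap phi2 1%g a) (L v).
Proof.
move=> r1 r2 s1 s2 e1 e2 linL LE a v.
have [d1 E1] := diff_rep_pull a v r1 s1 e1.
have [d2 E2] := diff_rep_pull a (L v) r2 s2 e2.
have [_ E3] := is_diff_linear_comp linL (rV_fin_basis _) d1.
apply: etrans (congr1 L (esym E1)) _; apply: etrans _ E2.
apply: etrans (esym (congr1 (fun h => h a) E3)) _.
have -> : (fun u => L (rho1 (phi1 (param (unit_chart P) u)) v)) =
    (fun u => rho2 (phi2 (param (unit_chart P) u)) (L v)) by apply/funext => u.
by [].
Qed.

Lemma morphism1 P G (phi : P -> G) :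
  {morph phi : x y / (x * y)%g >-> (x * y)%g} -> phi 1%g = 1%g.
Proof.
move=> phiM; have /(congr1 (fun x => x * (phi 1%g)^-1)%g) := phiM 1%g 1%g.
by rewrite mulg1 mulgK mulgV.
Qed.

(** A morphism of groups intertwines conjugations, so this is
    [rep_diff_intertwine] for the adjoint representations. *)
Lemma tmap_lie_bracket P G (phi : P -> G) (a b : tangent (1%g : P)) :
  lie_group_morphism phi ->
  tmap phi 1%g (lie_bracket a b) =
    @lie_bracket R G (tmap phi 1%g a) (tmap phi 1%g b) :> 'rV[R]_(mdim G).
Proof.
move=> [/smooth_preserves sphi phiM]; have phi1 := morphism1 phiM.
have phiV x : phi (x^-1)%g = (phi x)^-1%g.
  by apply: (mulgI (phi x)); rewrite -phiM !mulgV.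
rewrite -!rep_diff_Ad.
have := @rep_diff_intertwine P P G _ _ (@Ad R P) (@Ad R G) id phi (tmap phi 1%g)
  (Ad_rep P) (Ad_rep G) _ sphi _ phi1 (@tmap_linear _ _ _ phi 1%g) _ a b.
rewrite tmap_id; apply => // k v.
have pc (H : lieGroupType R) (g : H) := preserves_smooth2_r g (@gconj_smooth R H).
rewrite /Ad /isotropy.
have E1 := tmap_comp v (gconj1 k) (pc _ k) sphi.
have E2 := tmap_comp v phi1 sphi (pc _ (phi k)).
apply: etrans (esym E1) _; apply: etrans _ E2.
have -> : phi \o gconj k = gconj (phi k) \o phi.
  by apply/funext => x; rewrite /= /gconj !phiM phiV.
by [].
Qed.

End Intertwine.

(** * Continuous maps through immersions *)

Section Immersion.
Context {R : realType}.

Definition rV_linear_fun m n (D : 'rV[R]_m -> 'rV[R]_n) (lD : linear D) :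
    {linear 'rV[R]_m -> 'rV[R]_n} :=
  HB.pack D (GRing.isLinear.Build _ _ _ _ _ lD).

Lemma range_linear_kernel m n (D : 'rV[R]_m -> 'rV[R]_n) : linear D ->
  exists C : {linear 'rV[R]_n -> 'rV[R]_n}, forall x, range D x <-> C x = 0.
Proof.
move=> lD; pose A := lin1_mx (rV_linear_fun lD).
exists (mulmxr (cokermx A)) => x /=.
split=> [[y _ <-]|/eqP Cx0].
  have -> : D y = y *m A by rewrite mul_rV_lin1.
  by rewrite -mulmxA mulmx_coker mulmx0.
have /submxP[y ->] : (x <= A)%MS by rewrite submxE.
by exists y => //; rewrite mul_rV_lin1.
Qed.

Lemma injective_linear_bound m n (D : 'rV[R]_m -> 'rV[R]_n) :
  linear D -> injective D ->
  exists2 k : R, 0 < k & forall x, `|x| <= k * `|D x|.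
Proof.
move=> lD iD; pose A := lin1_mx (rV_linear_fun lD).
have AE y : y *m A = D y by rewrite mul_rV_lin1.
have /row_freeP[B AB] : row_free A.
  apply/inj_row_free => v; rewrite AE => Dv; apply: iD; rewrite Dv.
  exact: esym (linear0 (rV_linear_fun lD)).
have [k k0 kB] := linear_lipschitz
  (@fin_linear_continuous _ _ _
    (mulmxr B : {linear 'rV[R]_n -> 'rV[R]_m}) (rV_fin_basis n)).
exists k => // x; apply: le_trans (kB (D x)).
by rewrite /= -AE -mulmxA AB mulmx1.
Qed.

(** The lift [rho] is only assumed continuous. As [i] is an immersion, [rho x'
    - rho x] is bounded by a multiple of [phi x' - phi x], hence of [x' - x];
    so a linear map [C] that vanishes on the range of ['d i (rho x)] has [C \o
    phi] with zero derivative. *)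
Lemma diff_through_immersion (V : normedModType R) m n
    (i : 'rV[R]_m -> 'rV[R]_n) (phi : V -> 'rV[R]_n) (rho : V -> 'rV[R]_m) x v :
  differentiable i (rho x) -> injective ('d i (rho x)) ->
  {for x, continuous rho} -> differentiable phi x ->
  {near x, phi =1 i \o rho} -> range ('d i (rho x)) ('d phi x v).
Proof.
move=> di inj_i crho dphi phiE.
have linD : linear ('d i (rho x)) by move=> a u w; exact: linearP.
have [C CP] := range_linear_kernel linD.
have [k k0 kD] := injective_linear_bound linD inj_i.
have Cc : continuous C by exact: (@fin_linear_continuous _ _ _ C (rV_fin_basis n)).
have [kC kC0 CB] := linear_lipschitz Cc.
have [K K0 KB] := linear_lipschitz (diff_continuous dphi).
have CD w : C ('d i (rho x) w) = 0 by apply/CP; exists w.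
pose Z : {linear V -> 'rV[R]_n} := \0.
have dC : is_diff x (C \o phi) Z.
  apply: is_diff_eps; first by move=> y; exact: cvg_cst.
  move=> e e0.
  (* The first bound on [eta] lets [k * (eta * `|r|)] be absorbed by [`|r|] in
     [e4]; the second one makes the final estimate [e * `|y - x|]. *)
  pose eta := Num.min (2 * k)^-1 (e / (kC * (2 * k * (K + 1)))).
  have p0 : 0 < kC * (2 * k * (K + 1)).
    by rewrite !mulr_gt0 // addr_gt0.
  have eta0 : 0 < eta by rewrite lt_min invr_gt0 mulr_gt0 //= divr_gt0.
  have N1 : \forall y \near x, `|i (rho y) - i (rho x) -
      'd i (rho x) (rho y - rho x)| <= eta * `|rho y - rho x|.
    exact: crho _ (diff_eps di eta0).
  have N2 := diff_eps dphi ltr01.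
  near=> y.
  have phy : phi y = i (rho y) by near: y; exact: phiE.
  have phx : phi x = i (rho x) by exact: nbhs_singleton phiE.
  have e1 : `|phi y - phi x - 'd i (rho x) (rho y - rho x)| <=
      eta * `|rho y - rho x| by rewrite phy phx; near: y; exact: N1.
  have e2 : `|phi y - phi x - 'd phi x (y - x)| <= 1 * `|y - x|.
    by near: y; exact: N2.
  have e3 : `|phi y - phi x| <= (K + 1) * `|y - x|.
    rewrite -[X in `|X|](subrK ('d phi x (y - x))).
    apply: le_trans (ler_normD _ _) _.
    by rewrite addrC mulrDl lerD.
  set r := rho y - rho x in e1 *.
  have e4 : `|r| <= 2 * k * `|phi y - phi x|.
    have h1 : `|'d i (rho x) r| <= `|phi y - phi x| + eta * `|r|.
      rewrite -[X in `|X|](subKr (phi y - phi x)).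
      by apply: le_trans (ler_normB _ _) _; rewrite lerD2l.
    have h2 : k * (eta * `|r|) <= `|r| / 2.
      rewrite mulrA [leRHS]mulrC ler_wpM2r // -ler_pdivlMl // -invfM.
      by rewrite mulrC ge_min lexx.
    have h3 : k * `|'d i (rho x) r| <= k * (`|phi y - phi x| + eta * `|r|).
      by rewrite ler_pM2l.
    have := kD r; move: h2 h3; rewrite mulrDr -mulrA.
    set t1 := k * `|'d i _ _|; set t2 := k * (eta * _); set t3 := k * `|phi y - _|.
    set t4 := `|r|; lra.
  have -> : (C \o phi) y - (C \o phi) x - Z (y - x) =
      C (phi y - phi x - 'd i (rho x) r).
    have Z0 : Z (y - x) = 0 by [].
    have CB' u w : C (u - w) = C u - C w by exact: linearB.
    by rewrite Z0 subr0 CB' CD subr0 CB'.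
  apply: le_trans (CB _) _; apply: le_trans (ler_wpM2l (ltW kC0) e1) _.
  have e5 : `|r| <= 2 * k * (K + 1) * `|y - x|.
    have k2 : 0 <= 2 * k by rewrite mulr_ge0 // ltW.
    by apply: le_trans e4 _; have := ler_wpM2l k2 e3; rewrite mulrA.
  apply: le_trans (ler_wpM2l (ltW kC0) (ler_wpM2l (ltW eta0) e5)) _.
  rewrite !mulrA ler_wpM2r //.
  have : eta <= e / (kC * (2 * k * (K + 1))) by rewrite ge_min lexx orbT.
  by rewrite ler_pdivlMr // => h; apply: le_trans h; rewrite !mulrA [kC * eta]mulrC.
have [_ E] := is_diff_lin_comp Cc dphi.
apply/CP; apply: etrans (esym (congr1 (fun h => h v) E)) _.
by case: dC => _ ->.
Unshelve. all: by end_near. Qed.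

End Immersion.

(** * Countable unions of compact sets *)

Section Topology.
Context {R : realType}.

Lemma compact_nbhs (M : manifoldType R) (p : M) :
  exists2 K : set M, compact K & nbhs p K.
Proof.
have dc := chart_at_dom p; set c := chart_at p in dc *.
have [r rc] := (nbhs_closedballP _ _).1 (near_cod (coord_cod dc)).
exists (param c @` closed_ball (coord c p) r%:num).
  apply: continuous_compact.
    apply: continuous_in_subspaceT => u /set_mem/rc cu.
    exact: param_continuous (mem_set cu).
  apply: bounded_closed_compact; last exact: closed_ball_closed.
  rewrite closed_ballE //; exists (`|coord c p| + r%:num); split=> //.
  move=> M0 M0b u /= h.
  rewrite -(subKr (coord c p) u) (le_trans (ler_normB _ _)) //.
  by apply: le_trans (ltW M0b); rewrite lerD2l.
have cc : {for p, continuous (coord c)}.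
  exact: coord_continuous (mem_set dc).
have : \forall q \near p, closed_ball (coord c p) r%:num (coord c q).
  exact: cc _ ((nbhs_closedballP _ _).2 (ex_intro _ r (@subset_refl _ _))).
apply: filterS2 (near_dom dc) => q dq cq.
by exists (coord c q) => //; exact: param_coord.
Qed.

(** Each basic open set contained in some compact set selects one such compact
    set; these are countably many and cover [M]. *)
Lemma sigma_compact (M : manifoldType R) : exists K : nat -> set M,
  (forall i, compact (K i)) /\ forall p, exists i, K i p.
Proof.
have [B /countable_injP[f fI] [_ Bb]] := @manifold_second_countable R M.
pose P i := [set K : set M | compact K /\
  exists2 U, B U /\ f U = i & U `<=` K].
(* The default [set0] serves the indices that select no compact set. *)
exists (fun i => xget set0 (P i)); split=> [i|p].
  by case: xgetP => [K _ []|] //; move=> _; exact: compact0.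
have [K cK Kp] := compact_nbhs p.
have [U [BU Up] UK] := Bb p _ Kp.
exists (f U); have : P (f U) (xget set0 (P (f U))).
  by apply: xgetPex; exists K; split=> //; exists U.
move=> [_ [U' [BU' fU'] U'K]]; apply: U'K.
by rewrite (fI _ _ (mem_set BU') (mem_set BU) fU').
Qed.

(** On a compact set a continuous injection into a Hausdorff space is a
    homeomorphism onto its image. *)
Lemma continuous_lift (T H G : topologicalType) (f : H -> G) (g : T -> H)
    (K : set H) (x : T) :
  hausdorff_space G -> continuous f -> injective f -> compact K ->
  {for x, continuous (f \o g)} -> (\forall y \near x, K (g y)) ->
  {for x, continuous g}.
Proof.
move=> hG cf fI cK cfg Kg A; rewrite nbhsE => -[U [oU Ug] UA].
(* The image of the part of [K] outside [U] is closed and misses [f (g x)]. *)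
have cKU : compact (K `&` ~` U) by apply: compact_closedI => //; exact: open_closedC.
have cl : closed (f @` (K `&` ~` U)).
  apply: compact_closed => //; apply: continuous_compact cKU.
  exact: continuous_subspaceT.
have nx : (~` (f @` (K `&` ~` U))) (f (g x)).
  by move=> [h [_ nU] /fI E]; apply: nU; rewrite E.
have N := cfg _ (open_nbhs_nbhs (conj (closed_openC cl) nx)).
rewrite /= nbhs_filterE.
apply: filterS2 Kg N => y Ky /= nfy; apply: UA.
by apply: contrapT => nU; apply: nfy; exists (g y).
Qed.

(** If an open set of a complete space is mapped into a countable union of
    closed sets, then by Baire's theorem some smaller open set is mapped into
    one of them. *)
Lemma baire_piece (V : completeNormedModType R) (G : topologicalType)
    (T : V -> G) (K : nat -> set G) (N : set V) (x : V) :
  nbhs x N -> (forall u, N u -> {for u, continuous T}) ->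
  (forall i, closed (K i)) -> (forall u, N u -> exists i, K i (T u)) ->
  exists i, exists2 u, N u & \forall w \near u, K i (T w).
Proof.
move=> Nx cT cK cov; have [r rN] := (nbhs_closedballP _ _).1 Nx.
pose Q := closed_ball x r%:num.
pose E i := ~` (Q `&` T @^-1` K i).
have oE i : open (E i).
  rewrite openE => u /= nQ; rewrite /interior.
  have [Qu|nQu] := pselect (Q u); last first.
    have : nbhs u (~` Q).
      apply: open_nbhs_nbhs; split=> //; apply: closed_openC.
      exact: closed_ball_closed.
    by apply: filterS => w nw [].
  have nK : (~` K i) (T u) by move=> h; apply: nQ.
  have : \forall w \near u, (~` K i) (T w).
    exact: cT u (rN _ Qu) _ (open_nbhs_nbhs (conj (closed_openC (cK i)) nK)).
  by apply: filterS => w nw [].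
have [dE|/existsNP[i ndE]] := pselect (forall i, dense (E i)).
  have D := Baire (fun i => conj (oE i) (dE i)).
  have [||u [bu Eu]] := D (ball x r%:num).
  - by exists x; exact: ballxx.
  - exact: ball_open.
  have Qu : Q u by exact: subset_closed_ball bu.
  have [i Kiu] := cov _ (rN _ Qu).
  by have := Eu i I; case.
have [A [[u [oA Au]] AE]] := denseNE ndE.
have subA (w : V) : A w -> Q w /\ K i (T w).
  move=> Aw; apply: contrapT => nw.
  have : (A `&` E i) w by split=> // -[q k]; apply: nw.
  by rewrite AE.
exists i; exists u; first by have [/rN] := subA _ Au.
by apply: (open_near oA Au) => w /subA[].
Qed.

End Topology.

(** * Smooth maps into an immersed subgroup *)

(** Completeness and norm of row vectors are both known; this joins them, for
    Baire's theorem. *)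
HB.instance Definition _ (R : realType) n := Complete.on 'rV[R]_n.

Section TangentSubgroup.
Context {R : realType}.
Variables (G : lieGroupType R) (S : lieSubgroup G) (M : manifoldType R).
Variables (f : M -> G) (p : M).
Hypotheses (f_smooth : preserves_smooth f) (f_p : f p = 1%g).
Hypothesis f_range : range f `<=` range (@incl _ _ S).

Local Notation H := (subgroup S).
Local Notation i := (@incl _ _ S).
Local Notation c := (chart_at p).
Local Notation w0 := (coord (chart_at p) p).
Local Notation T := (fun u => f (param (chart_at p) u)).
Local Notation That := (fun u => coord (unit_chart G) (f (param (chart_at p) u))).

(** Left translation by [(T u)^-1] brings the derivatives of [f] at all points
    near [p] to the tangent space at the unit, where they can be compared with
    the range of [tmap i 1]. *)
Definition translated (u y : 'rV[R]_(mdim M)) : 'rV[R]_(mdim G) :=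
  coord (unit_chart G) ((T u)^-1 * T y)%g.

Definition chart_ldiv (z : 'rV[R]_(mdim G) * 'rV[R]_(mdim G)) :=
  coord (unit_chart G) ((param (unit_chart G) z.1)^-1 * param (unit_chart G) z.2)%g.

Lemma incl1 : i 1%g = 1%g.
Proof. by have [_ /morphism1] := incl_morphism S. Qed.

Lemma incl_preserves : preserves_smooth i.
Proof. by have [/smooth_preserves] := incl_morphism S. Qed.

Lemma chart_ldiv_smooth : smooth_near chart_ldiv (unit_coord G, unit_coord G).
Proof.
have s1 : smooth_at (fun z : 'rV[R]_(mdim G) * 'rV[R]_(mdim G) =>
    (param (unit_chart G) z.1)^-1%g) (unit_coord G, unit_coord G).
  apply: (@invg_preserves R G).
  exact: smooth_at_param_fst (unit_chart_atlas G) (unit_coord_cod G).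
have [_] := mulg_preserves s1
  (smooth_at_param_snd (unit_coord G) (unit_chart_atlas G) (unit_coord_cod G)).
apply; first exact: unit_chart_atlas.
by rewrite /= param_unit_coord mulVg; exact: unit_chart1.
Qed.

Lemma smooth_at_T u : cod c u -> smooth_at T u.
Proof. by move=> cu; apply: f_smooth; exact: smooth_at_param (chart_at_atlas p) cu. Qed.

Lemma That_smooth : smooth_near That w0.
Proof.
have [_] := smooth_at_T (chart_at_cod p); apply; first exact: unit_chart_atlas.
by rewrite /= param_chart_at f_p; exact: unit_chart1.
Qed.

Lemma diff_translatedE v : \forall u \near w0, 'd (translated u) u v =
  'd chart_ldiv (That u, That u) (0, 'd That u v).
Proof.
have Tw0 : That w0 = unit_coord G by rewrite /= param_chart_at f_p.
near=> u.
have cu : cod c u by near: u; exact: near_cod (chart_at_cod p).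
have dTu : dom (unit_chart G) (T u).
  near: u; apply: smooth_at_dom (smooth_at_T (chart_at_cod p)) _.
  by rewrite param_chart_at f_p; exact: unit_chart1.
have dT : differentiable That u by near: u; exact: smooth_near_diff That_smooth.
have dn : differentiable chart_ldiv (That u, That u).
  near: u.
  have cT : {for w0, continuous (fun u => (That u, That u))}.
    exact: smooth_near_continuous (smooth_near_pair That_smooth That_smooth).
  have N := smooth_near_diff chart_ldiv_smooth.
  rewrite -Tw0 in N.
  exact: (cT _ N).
have dp : differentiable (fun y => (That u, That y)) u.
  exact: differentiable_pair (differentiable_cst _ _) dT.
have E : 'd (fun y => (That u, That y)) u v = (0, 'd That u v).
  apply: etrans (congr1 (fun h => h v)
    (diff_pair (differentiable_cst (That u) u) dT)) _.
  congr pair; exact: (congr1 (fun h => h v) (@diff_cst _ _ _ (That u) u)).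
apply: etrans (etrans (diff_compE v dp dn) (congr1 ('d chart_ldiv _) E)).
apply: (congr1 (fun h => h v)); apply: near_eq_diff; last first.
  exact: (differentiable_comp dp dn).
apply: filterS (smooth_at_factor (smooth_at_T cu) dTu) => y yE.
by rewrite /translated /chart_ldiv /= yE param_coord.
Unshelve. all: by end_near. Qed.

Lemma diff_translated_continuous v :
  {for w0, continuous (fun u => 'd (translated u) u v : 'rV[R]_(mdim G))} /\
  'd (translated w0) w0 v = tmap f p v.
Proof.
have Tw0 : That w0 = unit_coord G by rewrite /= param_chart_at f_p.
have dT := smooth_near_differentiable That_smooth.
have sn : smooth_near chart_ldiv (That w0, That w0).
  by rewrite Tw0; exact: chart_ldiv_smooth.
have dw : differentiable (fun u => (0, 'd That u v) :
    'rV[R]_(mdim G) * 'rV[R]_(mdim G)) w0.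
  apply: differentiable_pair; first exact: differentiable_cst.
  exact/smooth_near_differentiable/smooth_near_d/That_smooth.
have [dk _] := diff_apply (h := fun u => (That u, That u)) v
  (prod_fin_basis (rV_fin_basis _) (rV_fin_basis _)) sn
  (differentiable_pair dT dT) dw.
have E := diff_translatedE v; split.
  apply: near_eq_continuous (differentiable_continuous dk).
  by apply: filterS E => u uE; exact: esym uE.
apply: etrans (nbhs_singleton E) _.
have dn := smooth_near_differentiable sn.
apply: etrans (esym (diff_partial_r ('d That w0 v) dn)) _.
have -> : tmap f p v = 'd That w0 v by rewrite (tmap_chart (q := 1%g)).
rewrite Tw0; apply: diff_near_id.
apply: filterS (near_cod (unit_coord_cod G)) => y cy.
by rewrite /chart_ldiv /= param_unit_coord invg1 mul1g coord_param.
Qed.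

(** Left translation turns a continuous lift [b] of [f] into the continuous
    lift [y |-> (b u)^-1 * b y] of its translate, which passes through the
    unit at [u]; there [i] is an immersion and [diff_through_immersion]
    applies. *)
Lemma range_diff_translated (b : 'rV[R]_(mdim M) -> H) u v : cod c u ->
  {for u, continuous b} -> (\forall y \near u, T y = i (b y)) ->
  range (tmap i 1%g) ('d (translated u) u v).
Proof.
move=> cu cb Tb; have Tu := nbhs_singleton Tb.
pose g y : H := ((b u)^-1 * b y)%g.
pose rho y := coord (unit_chart H) (g y).
have gu : g u = 1%g by rewrite /g mulVg.
have cg : {for u, continuous g}.
  have cm : continuous (fun x : H => ((b u)^-1 * x)%g).
    apply: preserves_smooth_continuous.
    exact: (preserves_smooth2_r _ (@mulg_preserves R H)).
  exact: (continuous_comp cb (cm _)).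
have rhou : rho u = unit_coord H by rewrite /rho gu.
have crho : {for u, continuous rho}.
  apply: (continuous_comp cg); rewrite gu.
  exact: coord_continuous (mem_set (unit_chart1 H)).
pose ihat := coord (unit_chart G) \o i \o param (unit_chart H).
have dihat : differentiable ihat (rho u).
  rewrite rhou; apply: smooth_near_differentiable.
  apply: (smooth_at_chart incl_preserves (unit_chart_atlas H) (unit_chart1 H)
    (unit_chart_atlas G)).
  by rewrite incl1; exact: unit_chart1.
have DE : ('d ihat (rho u) : _ -> _) = tmap i 1%g.
  by apply/funext => a; rewrite rhou (tmap_chart (q := 1%g)) ?incl1.
suff [a _ aE] : range ('d ihat (rho u)) ('d (translated u) u v).
  exists a; first exact: I.
  exact: etrans (esym (congr1 (fun h => h a) DE)) aE.
apply: (diff_through_immersion (rho := rho)); [exact: dihat| |exact: crho| |].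
- have tr (F F' : 'rV[R]_(mdim H) -> 'rV[R]_(mdim G)) :
    F = F' -> injective F' -> injective F by move=> ->.
  exact: tr DE (@incl_immersion _ _ S 1%g).
- have [_] : smooth_at (fun y => (T u)^-1 * T y)%g u.
    apply: mulg_preserves; [exact: smooth_at_cst|exact: smooth_at_T].
  move=> /(_ _ (unit_chart_atlas G)) h; apply: smooth_near_differentiable.
  by apply: h; rewrite mulVg; exact: unit_chart1.
have N : \forall y \near u, dom (unit_chart H) (g y).
  by apply: cg; rewrite gu; exact: near_dom (unit_chart1 H).
apply: filterS2 Tb N => y Ty gy.
have [_ iM] := incl_morphism S.
have iV x : i (x^-1)%g = (i x)^-1%g.
  by apply: (mulgI (i x)); rewrite -iM !mulgV incl1.
apply: (@etrans _ _ (coord (unit_chart G) (i (g y)))).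
  by rewrite /translated Tu Ty /g iM iV.
exact: (congr1 (fun h : H => coord (unit_chart G) (i h)) (esym (param_coord gy))).
Qed.

(** As [H] is a countable union of compact sets, [baire_piece] and
    [continuous_lift] make [range_diff_translated] applicable at points
    arbitrarily close to [p]. The range of [tmap i 1] is closed, being the
    kernel of [C], and translated derivatives are continuous, so the
    conclusion passes to [p]. *)
Lemma tangent_in_subgroup v : range (tmap i 1%g) (tmap f p v).
Proof.
have lin : linear (tmap i 1%g) by exact: tmap_linear.
have [C CP] := range_linear_kernel lin.
have Cc : continuous C by exact: (@fin_linear_continuous _ _ _ C (rV_fin_basis _)).
have [cw w0E] := diff_translated_continuous v.
rewrite -w0E; apply/CP; apply: contrapT => /eqP nz.
pose om u : 'rV[R]_(mdim G) := 'd (translated u) u v.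
have cC : {for w0, continuous (C \o om)} by exact: (continuous_comp cw (Cc _)).
(* [C (om u)] stays nonzero near [w0], but it vanishes at the point [u] that
   Baire's theorem provides below. *)
have N1 : \forall u \near w0, C (om u) != 0.
  exact: (cvgr_neq0 _ cC nz).
have N : \forall u \near w0, C (om u) != 0 /\ cod c u.
  exact: filterI N1 (near_cod (chart_at_cod p)).
have [K [cK covK]] := sigma_compact H.
have ci := preserves_smooth_continuous incl_preserves.
have hG : hausdorff_space G by exact: manifold_hausdorff.
have [b bE] : exists b : 'rV[R]_(mdim M) -> H, forall u, T u = i (b u).
  have h u : exists h : H, T u = i h.
    by have [h _ <-] := f_range (imageT f (param c u)); exists h.
  by have [b bP] := choice h; exists b.
have cT u : cod c u -> {for u, continuous T} by move=> /smooth_at_T[].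
have clK j : closed (i @` K j).
  apply: (compact_closed hG); apply: continuous_compact (cK j).
  exact: continuous_subspaceT.
have Tcov u : (exists j, (i @` K j) (T u)).
  by have [j Kj] := covK (b u); exists j, (b u).
have [j [u [nzu cu] Kj]] := @baire_piece R 'rV[R]_(mdim M) G T
  (fun j => i @` K j) _ w0 N (fun u h => cT u h.2) clK (fun u _ => Tcov u).
have cb : {for u, continuous b}.
  apply: (continuous_lift hG ci (@incl_inj _ _ S) (cK j)).
    have -> : i \o b = T by apply/funext => y; rewrite /= bE.
    exact: cT.
  by apply: filterS Kj => y [h Kh]; rewrite bE => /(@incl_inj _ _ S) <-.
have Tb : \forall y \near u, T y = i (b y) by exact: filterE bE.
have Cu := (CP _).1 (range_diff_translated v cu cb Tb).
by move/eqP: nzu; apply; exact: Cu.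
Qed.

End TangentSubgroup.

(** * The tangent relaxed augmented Leibniz algebra *)

Section Rack.
Context {R : realType} (A : relaxedAugmentedLieRack R).

Local Notation G := (rack_group A).
Local Notation act := (@rack_act R A).
Local Notation e := (rack_pt A).
Local Notation Theta := (@rack_Theta R A).
Local Notation i := (@incl _ _ (rack_sub A)).

Lemma rack_act_mul g h x : act (g * h)%g x = act g (act h x).
Proof. by have [_ ->] := rack_actP A. Qed.

Lemma rack_act_preserves : preserves_smooth2 act.
Proof. by have [_ _ /smooth2_preserves] := rack_actP A. Qed.

Lemma tangent_L_rep : smooth_rep (isotropy act e).
Proof. exact: isotropy_rep rack_act_mul (@rack_act_pt R A) rack_act_preserves. Qed.

Lemma is_derive_tangent_L (x : tangent_lie A) (v : tangent_space A)
    (a : R^o -> rack_group A) :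
  {for 0, continuous a} -> a 0 = 1%g -> velocity a 0 x ->
  is_derive (0 : R^o) (1 : R^o) (fun t => tangent_L (a t) v) (tangent_act x v).
Proof.
move=> ca a0; rewrite /velocity a0 => -[dg gE].
pose g : R^o -> 'rV[R]_(mdim G) := coord (unit_chart G) \o a.
pose f (u : 'rV[R]_(mdim G)) := isotropy act e (param (unit_chart G) u) v.
have dg' : differentiable g 0 by apply/derivable1_diffP.
have g0 : g 0 = unit_coord G by rewrite /g /= a0.
have df : differentiable f (g 0).
  by rewrite g0; exact: rep_differentiable tangent_L_rep v.
have dfg := differentiable_comp dg' df.
have N : \forall t \near (0 : R^o), dom (unit_chart G) (a t).
  by apply: ca; rewrite a0; exact: near_dom (unit_chart1 G).
apply: (near_eq_is_derive (f := f \o g)).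
  by apply: filterS N => t /param_coord E; rewrite /f /g /= E.
have dgE : 'd g 0 (1 : R^o) = x by have <- := deriveE (1 : R^o) dg'; exact: gE.
apply: DeriveDef; first exact: diff_derivable.
apply: etrans (deriveE (1 : R^o) dfg) _.
apply: etrans (congr1 (fun h => h (1 : R^o)) (diff_comp dg' df)) _.
by rewrite /= g0; exact: (congr1 ('d f (unit_coord G)) dgE).
Qed.

Lemma Theta_preserves : preserves_smooth Theta.
Proof. exact/smooth_preserves/rack_Theta_smooth. Qed.

(** On the subgroup, [Theta] intertwines the action on the rack with
    conjugation, so this is [rep_diff_intertwine] for the isotropy and the
    adjoint representation, both pulled back to the subgroup. *)
Lemma tangent_theta_act (a : tangent (1%g : subgroup (rack_sub A))) v :
  tangent_theta (tangent_act (tmap i 1%g a) v) =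
    tangent_bracket (tmap i 1%g a) (tangent_theta v).
Proof.
have i1 := incl1 (rack_sub A); have si := @incl_preserves _ _ (rack_sub A).
apply: etrans (rep_diff_intertwine (rho1 := isotropy act e) (rho2 := @Ad R G)
  (L := tmap Theta e) tangent_L_rep (Ad_rep G) si si i1 i1
  (@tmap_linear _ _ _ Theta e) _ a v) _; last exact: rep_diff_Ad.
move=> k w.
have E1 := tmap_comp w (rack_act_pt (i k))
  (preserves_smooth2_r (i k) rack_act_preserves) Theta_preserves.
have E2 := tmap_comp w (rack_Theta_pt A) Theta_preserves
  (preserves_smooth2_r (i k) (@gconj_smooth R G)).
apply: etrans (esym E1) (etrans _ E2).
have -> : Theta \o act (i k) = gconj (i k) \o Theta; last by [].
by apply/funext => x; rewrite /= rack_Theta_act.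
Qed.

Lemma tangent_relaxed_augmented_leibniz :
  relaxed_augmented_leibniz (@tangent_bracket R A) (@tangent_act R A)
    (@tangent_theta R A) (@tangent_sub R A).
Proof.
split.
- exact: lie_bracket_lie_algebra.
- split; first exact: rep_diff_bilinear tangent_L_rep.
  exact: (rep_diff_module tangent_L_rep).
- by exact: (@tmap_linear _ _ _ Theta e).
- split.
  + exists 0 => //; exact: (linear0 (rV_linear_fun (@tmap_linear _ _ _ i 1%g))).
  + move=> r _ _ [a _ <-] [b _ <-]; exists (r *: a + b) => //.
    exact: tmap_linear.
  + move=> _ _ [a _ <-] [b _ <-]; exists (lie_bracket a b) => //.
    exact: tmap_lie_bracket (incl_morphism _).
- move=> _ [v _ <-]; apply: tangent_in_subgroup.
  + exact: Theta_preserves.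
  + exact: rack_Theta_pt.
  + exact: rack_Theta_sub.
- by move=> _ [a _ <-] v; exact: tangent_theta_act.
Qed.

End Rack.

Theorem proposition15 (R : realType) :
  (forall A : relaxedAugmentedLieRack R,
     (forall (x : tangent_lie A) (v : tangent_space A)
             (a : R^o -> rack_group A),
        smooth_into (`]-1, 1[ : set R^o) a -> a 0 = 1%g -> velocity a 0 x ->
        is_derive (0 : R^o) (1 : R^o) (fun t => tangent_L (a t) v)
          (tangent_act x v)) /\
     relaxed_augmented_leibniz (@tangent_bracket R A) (@tangent_act R A)
       (@tangent_theta R A) (@tangent_sub R A)) /\
  (forall (A1 A2 : relaxedAugmentedLieRack R)
          (Phi : rack_group A1 -> rack_group A2)
          (Psi : rack_space A1 -> rack_space A2),
     triple_morphism Phi Psi ->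
     lie_leibniz_morphism
       (@tangent_bracket R A1) (@tangent_act R A1) (@tangent_theta R A1)
       (@tangent_bracket R A2) (@tangent_act R A2) (@tangent_theta R A2)
       (tmap Phi 1%g) (tmap Psi (rack_pt A1))).
Proof.
split=> [A|A1 A2 Phi Psi [mPhi sPsi Psi_e PsiT PsiA]].
  split; last exact: tangent_relaxed_augmented_leibniz.
  move=> x v a [ca _] a0 va; apply: is_derive_tangent_L va => //.
  by apply: ca; rewrite inE /= in_itv /= ltrN10 ltr01.
have [/smooth_preserves sPhi PhiM] := mPhi.
have Phi1 := morphism1 PhiM; have {}sPsi := smooth_preserves sPsi.
split.
- exact: ral_lie_leibniz_triple (tangent_relaxed_augmented_leibniz A1).
- exact: ral_lie_leibniz_triple (tangent_relaxed_augmented_leibniz A2).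
- exact: (@tmap_linear _ _ _ Phi 1%g).
- by move=> a b; exact: tmap_lie_bracket.
- exact: (@tmap_linear _ _ _ Psi (rack_pt A1)).
- move=> v.
  have E1 := tmap_comp v Psi_e sPsi (@Theta_preserves _ A2).
  have E2 := tmap_comp v (rack_Theta_pt A1) (@Theta_preserves _ A1) sPhi.
  apply: etrans (esym E1) (etrans _ E2).
  by have -> : @rack_Theta _ A2 \o Psi = Phi \o @rack_Theta _ A1 by apply/funext.
- move=> a v.
  have := @rep_diff_intertwine R (rack_group A1) (rack_group A1) (rack_group A2)
    _ _ _ _ id Phi (tmap Psi (rack_pt A1)) (tangent_L_rep A1) (tangent_L_rep A2)
    _ sPhi erefl Phi1 (@tmap_linear _ _ _ Psi (rack_pt A1)) _ a v.
  rewrite tmap_id; apply=> // k w.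
  have E1 := tmap_comp w (rack_act_pt k)
    (preserves_smooth2_r k (rack_act_preserves (A := A1))) sPsi.
  have E2 := tmap_comp w Psi_e sPsi
    (preserves_smooth2_r (Phi k) (rack_act_preserves (A := A2))).
  apply: etrans (esym E1) (etrans _ E2).
  have -> : Psi \o @rack_act _ A1 k = @rack_act _ A2 (Phi k) \o Psi; last by [].
  by apply/funext => x; rewrite /= PsiA.
Qed.
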